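(* Let $k$ be a field and let $A:=kQ/\langle Q_2\rangle$ where $Q$ is a finite quiver. If $Q$ is not an oriented cycle, then, for $n\ge1$, the Lie module structure on the Hochschild cohomology groups given by the Gerstenhaber bracket $$HH^1(A)\times HH^n(A)\longrightarrow HH^n(A)$$ is induced by the bilinear map $$k(Q_1\parallel Q_1)\times k(Q_n\parallel Q_1)\longrightarrow k(Q_n\parallel Q_1)$$ given by $$(a,x).(\alpha^n,y)=\delta_{y,a}\cdot(\alpha^n,x)-\sum_{i=1}^n\delta_{x,a_i}\cdot(\alpha^n\mathbin{\underset{i}{\diamond}}a,\,y),$$ where $a\parallel x$ are arrows, $y$ is an arrow parallel to (a shortcut of) the path $\alpha^n$, whose decomposition into arrows is $\alpha^n=a_1\cdots a_i\cdots a_n$, and the path $\alpha^n\mathbin{\underset{i}{\diamond}}a$ is obtained by replacing $a_i$ with $a$ if $a_i=x$.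
   Context: $Q_n$ is the set of paths of length $n$ in $Q$ ($Q_0$ vertices, identified with trivial paths; $Q_1$ arrows); $kQ$ is the path algebra, $\langle Q_2\rangle$ the two-sided ideal generated by the paths of length two. A single loop is regarded as an oriented cycle (of length one). $A=E\oplus r$ with $E=kQ_0$ and Jacobson radical $r=kQ_1$. Two paths are parallel ($\parallel$) if they have the same source and the same end; $X\parallel Y=\{(\gamma,\gamma')\in X\times Y:\gamma\parallel\gamma'\}$, and $k(X\parallel Y)$ is the vector space with basis $X\parallel Y$. $\delta_{u,v}$ is the Kronecker delta. $HH^n(A)=\mathrm{Ext}^n_{A^e}(A,A)$ is the cohomology of the complex with terms $k(Q_n\parallel Q_0)\oplus k(Q_n\parallel Q_1)$ whose differential is zero on $k(Q_n\parallel Q_1)$ and is $D_n:k(Q_n\parallel Q_0)\to k(Q_{n+1}\parallel Q_1)$ on the first summand, where $D_n(\gamma^n,e)=\sum_{a\in Q_1e}(a\gamma^n,a)+(-1)^{n+1}\sum_{a\in eQ_1}(\gamma^na,a)$ ($Q_1e$, resp. $eQ_1$, is the set of arrows $a$ with $ae=a$, resp. $ea=a$, in $kQ$). The word ''induced'' refers to the description $HH^n(A)\cong k(Q_n\parallel Q_1)/\mathrm{Im}\,D_{n-1}$ for $n\ge1$, coming from the injectivity of $D_n$ for $n\ge1$, which is quoted from Cibils for $Q$ neither a loop nor an oriented cycle. The class of $(\alpha,x)\in Q_n\parallel Q_1$ corresponds to the class of the Hochschild cocycle $A^{\otimes_kn}\to A$, $x_1\otimes\cdots\otimes x_n\mapsto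 f(\pi(x_1)\otimes_E\cdots\otimes_E\pi(x_n))$, where $\pi:A\to r$ is the projection along $A=E\oplus r$ and $f:r^{\otimes_En}\to A$ sends $\alpha$ to $x$ and every other path of length $n$ to $0$. Gerstenhaber bracket: for $f\in\mathrm{Hom}_k(A^{\otimes n},A)$, $g\in\mathrm{Hom}_k(A^{\otimes m},A)$, $n,m\ge1$, $f\circ g=\sum_{i=1}^n(-1)^{(i-1)(m-1)}f\circ_ig$, where $f\circ_ig$ inserts $g$ in the $i$-th argument of $f$, and $[f,g]=f\circ g-(-1)^{(n-1)(m-1)}g\circ f$; it induces a bracket $HH^n(A)\times HH^m(A)\to HH^{n+m-1}(A)$, so $HH^1(A)$ is a Lie algebra acting on each $HH^n(A)$.
   Formalization: ''Q is not an oriented cycle'' is read as ''no connected component of Q is an oriented cycle'' (the same for connected Q); with a cycle component, e.g. a loop plus an isolated point, D_2 is not injective and the description of HH^2(A) behind ''induced'' fails. *)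

(* Defs.v *)
From HB Require Import structures.
From mathcomp Require Import all_boot all_order all_algebra.
From mathcomp Require Import generic_quotient ring_quotient.
From mathcomp Require Import boolp functions.
Set Implicit Arguments.
Unset Strict Implicit.
Unset Printing Implicit Defensive.
Import GRing.Theory.
Local Open Scope ring_scope.

Section QuotientModule.
Variables (R : pzRingType) (V : lmodType R) (W : submodClosed V).

Definition submod_pred : {pred V} := W.

Lemma submod_pred_zmod : zmod_closed submod_pred.
Proof.
split=> [|x y xW yW]; first exact: (rpred0 W).
rewrite /submod_pred -scaleN1r; apply: (@rpredD _ W) => //.
exact: (@rpredZ _ _ W).
Qed.
HB.instance Definition _ := GRing.isZmodClosed.Build V submod_pred
  submod_pred_zmod.

Definition lquot : Type := Quotient.quot submod_pred.
HB.instance Definition _ := GRing.Zmodule.on lquot.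

Definition lclass (x : V) : lquot := \pi_(Quotient.quot submod_pred)%qT x.

Lemma lclass_is_zmod_morphism : zmod_morphism lclass.
Proof. by move=> x y; rewrite /lclass raddfB. Qed.
HB.instance Definition _ :=
  GRing.isZmodMorphism.Build V lquot lclass lclass_is_zmod_morphism.

Lemma lclass_eqE x y : (lclass x == lclass y) = (x - y \in W).
Proof.
by rewrite /lclass -[RHS]/(x - y \in submod_pred) Quotient.idealrBE.
Qed.

Definition lrepr (x : lquot) : V := repr (x : Quotient.quot submod_pred).

Lemma lreprK : cancel lrepr lclass.
Proof. by move=> x; rewrite /lclass /lrepr reprK. Qed.

Definition lquot_scale (a : R) (x : lquot) : lquot := lclass (a *: lrepr x).

Lemma lquot_scaleE a x : lquot_scale a (lclass x) = lclass (a *: x).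
Proof.
apply/eqP; rewrite lclass_eqE -scalerBr (@rpredZ _ _ W) //.
by rewrite -lclass_eqE lreprK.
Qed.

Lemma lquot_scaleA a b x :
  lquot_scale a (lquot_scale b x) = lquot_scale (a * b) x.
Proof. by rewrite -[x]lreprK !lquot_scaleE scalerA. Qed.
Lemma lquot_scale1 : left_id 1 lquot_scale.
Proof. by move=> x; rewrite -[x]lreprK lquot_scaleE scale1r. Qed.
Lemma lquot_scaleDr : right_distributive lquot_scale +%R.
Proof.
move=> a x y; rewrite -[x]lreprK -[y]lreprK -raddfD !lquot_scaleE.
by rewrite scalerDr raddfD.
Qed.
Lemma lquot_scaleDl x : {morph lquot_scale^~ x : a b / a + b}.
Proof. by move=> a b; rewrite -[x]lreprK !lquot_scaleE scalerDl raddfD. Qed.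
HB.instance Definition _ := GRing.Zmodule_isLmodule.Build R lquot
  lquot_scaleA lquot_scale1 lquot_scaleDr lquot_scaleDl.

Lemma lclass_is_scalable : scalable lclass.
Proof. by move=> a x; rewrite -lquot_scaleE. Qed.
HB.instance Definition _ :=
  GRing.isScalable.Build R V lquot *:%R lclass lclass_is_scalable.

End QuotientModule.

(* Quivers.  Paths are composed like functions: the product a b of two arrows *)
(* is a path when b ends where a starts, so that a e = a iff e is the source  *)
(* of a and e a = a iff e is its end.                                         *)

Record quiver := Quiver {
  vtx : finType;
  arr : finType;
  src : arr -> vtx;
  tgt : arr -> vtx
}.

Definition oriented_cycle (Q : quiver) : Prop :=
  exists l : nat, exists v : 'I_l.+1 -> vtx Q, exists a : 'I_l.+1 -> arr Q,
    [/\ bijective v, bijective a &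
        forall i, src (a i) = v i /\ tgt (a i) = v (ordS i)].

Section Component.
Variable Q : quiver.

Definition adjacent : rel (vtx Q) := fun v w =>
  [exists a : arr Q, ((src a == v) && (tgt a == w))
                  || ((src a == w) && (tgt a == v))].

Variable v : vtx Q.
Let cvtx := {w : vtx Q | connect adjacent v w}.
Let carr := {a : arr Q | connect adjacent v (src a)}.

Lemma component_tgt (a : carr) : connect adjacent v (tgt (val a)).
Proof.
apply: connect_trans (valP a) _; apply: connect1; apply/existsP.
by exists (val a); rewrite !eqxx.
Qed.

(* Excluding oriented cycles component by component makes every D_n, n >= 1,  *)
(* injective also for a quiver that is not connected.                         *)
Definition component : quiver :=
  @Quiver cvtx carr
    (fun a => exist (fun w => connect adjacent v w) (src (val a)) (valP a))
    (fun a => exist (fun w => connect adjacent v w) (tgt (val a))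
                (component_tgt a)).
End Component.

Lemma oriented_cycle_component (Q : quiver) (v : vtx Q) :
  (forall w, connect (@adjacent Q) v w) ->
  oriented_cycle (component v) <-> oriented_cycle Q.
Proof.
move=> cQ.
pose iv w : vtx (component v) := exist _ w (cQ w).
pose ia a : arr (component v) := exist _ a (cQ (src a)).
have bv : bijective iv.
  by exists val => [w|w] //; apply: val_inj.
have ba : bijective ia.
  by exists val => [a|a] //; apply: val_inj.
have bv' : bijective (val : vtx (component v) -> vtx Q).
  by exists iv => [w|w] //; apply: val_inj.
have ba' : bijective (val : arr (component v) -> arr Q).
  by exists ia => [a|a] //; apply: val_inj.
split=> -[l [f [g [bf bg fg]]]].
  exists l, (val \o f), (val \o g); split; [exact: bij_comp..|] => i /=.
  by have [<- <-] := fg i.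
exists l, (iv \o f), (ia \o g); split; [exact: bij_comp..|] => i /=.
by have [fi gi] := fg i; split; apply: val_inj.
Qed.

(* The algebra kQ/<Q_2>: it has the vertices and the arrows of Q as a basis,  *)
(* and the product of two basis elements is their concatenation, or 0 when    *)
(* they do not compose or when the concatenation has length two.  See         *)
(* radsq0_presentation below.                                                 *)

Section RadicalSquareZero.
Variables (k : fieldType) (Q : quiver).
Notation basis := (vtx Q + arr Q)%type.

Definition concat (b c : basis) : option basis :=
  match b, c with
  | inl e, inl f => if e == f then Some (inl e) else None
  | inl e, inr a => if e == tgt a then Some (inr a) else None
  | inr a, inl e => if src a == e then Some (inr a) else None
  | inr _, inr _ => None
  end.

Definition radsq0 : Type := {ffun basis -> k^o}.
HB.instance Definition _ := GRing.Lmodule.on radsq0.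

Definition radsq0_coef (x : radsq0) (b : basis) : k := (x : {ffun _ -> _}) b.
Definition radsq0_vec (b : basis) : radsq0 := [ffun c => (c == b)%:R].
Definition radsq0_one : radsq0 := \sum_(e : vtx Q) radsq0_vec (inl e).
Definition radsq0_mul (x y : radsq0) : radsq0 :=
  \sum_b \sum_c (radsq0_coef x b * radsq0_coef y c) *:
    (if concat b c is Some d then radsq0_vec d else 0).

Lemma radsq0P (x y : radsq0) : radsq0_coef x =1 radsq0_coef y -> x = y.
Proof. by move=> h; apply/ffunP. Qed.

Lemma radsq0_coefD x y b :
  radsq0_coef (x + y) b = radsq0_coef x b + radsq0_coef y b.
Proof. by rewrite /radsq0_coef ffunE. Qed.
Lemma radsq0_coefZ c x b : radsq0_coef (c *: x) b = c * radsq0_coef x b.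
Proof. by rewrite /radsq0_coef ffunE. Qed.
Lemma radsq0_coef0 b : radsq0_coef 0 b = 0.
Proof. by rewrite /radsq0_coef ffunE. Qed.
Lemma radsq0_coef_sum I (r : seq I) (P : pred I) (F : I -> radsq0) b :
  radsq0_coef (\sum_(i <- r | P i) F i) b =
  \sum_(i <- r | P i) radsq0_coef (F i) b.
Proof.
by elim/big_rec2: _ => [|i y z _ <-]; rewrite ?radsq0_coef0 ?radsq0_coefD.
Qed.
Lemma radsq0_coef_vec b c : radsq0_coef (radsq0_vec b) c = (c == b)%:R.
Proof. by rewrite /radsq0_coef ffunE. Qed.

Lemma sum_delta (T : finType) (F : T -> k) (a : T) :
  \sum_b F b * (a == b)%:R = F a.
Proof.
rewrite (bigD1 a) //= eqxx mulr1 big1 ?addr0 // => b ba.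
by rewrite eq_sym (negPf ba) mulr0.
Qed.

Lemma radsq0_coef_one b :
  radsq0_coef radsq0_one b = if b is inl _ then 1 else 0.
Proof.
rewrite radsq0_coef_sum; under eq_bigr do rewrite radsq0_coef_vec.
case: b => [e|a]; last by apply: big1.
by rewrite -[RHS](sum_delta (fun=> 1) e); apply: eq_bigr => f _; rewrite mul1r.
Qed.

Lemma radsq0_coef_mul x y b :
  radsq0_coef (radsq0_mul x y) b =
  match b with
  | inl e => radsq0_coef x (inl e) * radsq0_coef y (inl e)
  | inr a => radsq0_coef x (inl (tgt a)) * radsq0_coef y (inr a)
           + radsq0_coef x (inr a) * radsq0_coef y (inl (src a))
  end.
Proof.
rewrite radsq0_coef_sum.
under eq_bigr do rewrite radsq0_coef_sum.
rewrite big_sumType /=.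
case: b => [e|a].
  rewrite [X in _ + X]big1 ?addr0; last first.
    move=> a _; apply: big1 => c _; rewrite radsq0_coefZ.
    case: c => [f|c] /=; last by rewrite radsq0_coef0 mulr0.
    by case: ifP => _; rewrite ?radsq0_coef_vec ?radsq0_coef0 mulr0.
  rewrite -[RHS](sum_delta
    (fun f => radsq0_coef x (inl f) * radsq0_coef y (inl f)) e).
  apply: eq_bigr => f _; rewrite big_sumType /= [X in _ + X]big1 ?addr0.
    rewrite -(sum_delta (fun g => radsq0_coef x (inl f) * radsq0_coef y (inl g)) f).
    rewrite mulr_suml; apply: eq_bigr => g _; rewrite radsq0_coefZ.
    case: eqVneq => [<-|]; last by rewrite radsq0_coef0 !mulr0 mul0r.
    by rewrite radsq0_coef_vec mulr1.
  move=> a _; rewrite radsq0_coefZ.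
  by case: ifP => _; rewrite ?radsq0_coef_vec ?radsq0_coef0 mulr0.
congr (_ + _).
  transitivity (\sum_(e : vtx Q) radsq0_coef x (inl e) * radsq0_coef y (inr a)
                   * (tgt a == e)%:R); last by rewrite sum_delta.
  apply: eq_bigr => e _; rewrite big_sumType /= [X in X + _]big1 ?add0r.
    rewrite -(sum_delta (fun b => radsq0_coef x (inl e) * radsq0_coef y (inr b)) a).
    rewrite mulr_suml; apply: eq_bigr => c _; rewrite radsq0_coefZ.
    case: (eqVneq e (tgt c)) => [->|ne].
      rewrite radsq0_coef_vec -mulrA; congr (_ * _).
      rewrite -[inr a == inr c]/(a == c).
      by case: eqVneq => [->|]; rewrite ?eqxx ?mulr1 ?mul0r.
    rewrite radsq0_coef0 mulr0; case: (eqVneq a c) => [->|]; last first.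
      by rewrite mulr0 mul0r.
    by rewrite eq_sym (negPf ne) mulr0.
  move=> f _; rewrite radsq0_coefZ.
  by case: ifP => _; rewrite ?radsq0_coef_vec ?radsq0_coef0 mulr0.
rewrite -[RHS](sum_delta
  (fun b => radsq0_coef x (inr b) * radsq0_coef y (inl (src b))) a).
apply: eq_bigr => c _; rewrite big_sumType /= [X in _ + X]big1 ?addr0.
  rewrite -(sum_delta (fun e => radsq0_coef x (inr c) * radsq0_coef y (inl e))
             (src c)).
  rewrite mulr_suml; apply: eq_bigr => e _; rewrite radsq0_coefZ.
  case: (eqVneq (src c) e) => [_|_]; last by rewrite radsq0_coef0 !mulr0 mul0r.
  by rewrite radsq0_coef_vec mulr1.
by move=> d _; rewrite radsq0_coefZ radsq0_coef0 mulr0.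
Qed.

Lemma radsq0_mulA : associative radsq0_mul.
Proof.
move=> x y z; apply: radsq0P => -[e|a]; rewrite !radsq0_coef_mul ?mulrA //.
by rewrite mulrDl mulrDr !mulrA addrA.
Qed.
Lemma radsq0_mul1 : left_id radsq0_one radsq0_mul.
Proof.
move=> x; apply: radsq0P => -[e|a]; rewrite radsq0_coef_mul !radsq0_coef_one.
  by rewrite mul1r.
by rewrite mul1r mul0r addr0.
Qed.
Lemma radsq0_mulr1 : right_id radsq0_one radsq0_mul.
Proof.
move=> x; apply: radsq0P => -[e|a]; rewrite radsq0_coef_mul !radsq0_coef_one.
  by rewrite mulr1.
by rewrite mulr1 mulr0 add0r.
Qed.
Lemma radsq0_mulDl : left_distributive radsq0_mul +%R.
Proof.
move=> x y z; apply: radsq0P => -[e|a];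
  rewrite radsq0_coefD !radsq0_coef_mul !radsq0_coefD !mulrDl //.
by rewrite addrACA.
Qed.
Lemma radsq0_mulDr : right_distributive radsq0_mul +%R.
Proof.
move=> x y z; apply: radsq0P => -[e|a];
  rewrite radsq0_coefD !radsq0_coef_mul !radsq0_coefD !mulrDr //.
by rewrite addrACA.
Qed.
HB.instance Definition _ := GRing.Zmodule_isPzRing.Build radsq0
  radsq0_mulA radsq0_mul1 radsq0_mulr1 radsq0_mulDl radsq0_mulDr.

Lemma radsq0_scaleAl (c : k) (x y : radsq0) : c *: (x * y) = (c *: x) * y.
Proof.
apply: radsq0P => b; rewrite radsq0_coefZ !radsq0_coef_mul.
by case: b => [e|a]; rewrite !radsq0_coefZ ?mulrDr !mulrA.
Qed.
Lemma radsq0_scaleAr (c : k) (x y : radsq0) : c *: (x * y) = x * (c *: y).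
Proof.
apply: radsq0P => b; rewrite radsq0_coefZ !radsq0_coef_mul.
by case: b => [e|a]; rewrite !radsq0_coefZ ?mulrDr ![c * (_ * _)]mulrCA.
Qed.
Definition radsq0_arr (a : arr Q) : radsq0 := radsq0_vec (inr a).
Definition radsq0_vtx (e : vtx Q) : radsq0 := radsq0_vec (inl e).

(* The relations of kQ/<Q_2> for the images eps of the vertices and xi of the *)
(* arrows in an algebra B.                                                    *)
Definition radsq0_relations (B : pzRingType) (eps : vtx Q -> B)
    (xi : arr Q -> B) : Prop :=
  [/\ forall e f, eps e * eps f = if e == f then eps e else 0,
      \sum_e eps e = 1,
      forall a, eps (tgt a) * xi a = xi a,
      forall a, xi a * eps (src a) = xi a &
      forall a b, xi a * xi b = 0].

Lemma radsq0_vecM b c :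
  radsq0_vec b * radsq0_vec c =
  if concat b c is Some d then radsq0_vec d else 0.
Proof.
rewrite [LHS]/(radsq0_mul _ _) /radsq0_mul (bigD1 b) //= (bigD1 c) //=.
rewrite !radsq0_coef_vec !eqxx mulr1 scale1r.
rewrite big1 ?addr0 => [|d dc]; last first.
  by rewrite !radsq0_coef_vec (negPf dc) mulr0 scale0r.
rewrite big1 ?addr0 // => d db; apply: big1 => f _.
by rewrite !radsq0_coef_vec (negPf db) mul0r scale0r.
Qed.

Lemma radsq0_decomp (x : radsq0) :
  x = \sum_e radsq0_coef x (inl e) *: radsq0_vtx e
    + \sum_a radsq0_coef x (inr a) *: radsq0_arr a.
Proof.
apply: radsq0P => b; rewrite radsq0_coefD !radsq0_coef_sum.
under eq_bigr do rewrite radsq0_coefZ radsq0_coef_vec.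
under [X in _ + X]eq_bigr do rewrite radsq0_coefZ radsq0_coef_vec.
case: b => [e|a].
  rewrite [X in _ + X]big1 ?addr0; last by move=> a _; rewrite mulr0.
  by rewrite (sum_delta (fun f => radsq0_coef x (inl f))).
rewrite [X in X + _]big1 ?add0r; last by move=> e _; rewrite mulr0.
by rewrite (sum_delta (fun f => radsq0_coef x (inr f))).
Qed.

(* radsq0 has the universal property of kQ/<Q_2>: it satisfies its defining   *)
(* relations, and any other solution of them comes from a unique algebra map. *)
Lemma radsq0_presentation :
  radsq0_relations radsq0_vtx radsq0_arr
  /\ forall (B : algType k) (eps : vtx Q -> B) (xi : arr Q -> B),
       radsq0_relations eps xi ->
       exists! F : radsq0 -> B,
         [/\ linear F, monoid_morphism F, F \o radsq0_vtx =1 eps &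
             F \o radsq0_arr =1 xi].
Proof.
split.
  split=> [e f||a|a|a b]; rewrite ?radsq0_vecM //=.
  - by case: eqP.
  - by rewrite eqxx.
  - by rewrite eqxx.
move=> B eps xi [epsM eps1 tx xs xx].
pose F (x : radsq0) := \sum_e radsq0_coef x (inl e) *: eps e
  + \sum_a radsq0_coef x (inr a) *: xi a.
have linF : linear F.
  move=> c x y; rewrite /F scalerDr !scaler_sumr addrACA -!big_split /=.
  by congr (_ + _); apply: eq_bigr => i _;
    rewrite radsq0_coefD radsq0_coefZ scalerDl scalerA.
have epsx e a : eps e * xi a = if e == tgt a then xi a else 0.
  by rewrite -[in LHS](tx a) mulrA epsM; case: ifP => [/eqP->|]; rewrite ?tx ?mul0r.
have xeps a e : xi a * eps e = if src a == e then xi a else 0.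
  by rewrite -[in LHS](xs a) -mulrA epsM; case: ifP; rewrite ?xs ?mulr0.
have mulF x y : F (x * y) = F x * F y.
  have -> : F x * F y = \sum_e (radsq0_coef x (inl e) * radsq0_coef y (inl e)) *: eps e
     + (\sum_a (radsq0_coef x (inl (tgt a)) * radsq0_coef y (inr a)) *: xi a
     + \sum_a (radsq0_coef x (inr a) * radsq0_coef y (inl (src a))) *: xi a).
    rewrite /F mulrDl !mulrDr -!addrA; congr (_ + _).
      rewrite mulr_suml; apply: eq_bigr => e _; rewrite mulr_sumr.
      rewrite (bigD1 e) //= big1 ?addr0; last first.
        move=> f fe; rewrite -scalerAr -scalerAl epsM eq_sym (negPf fe).
        by rewrite !scaler0.
      by rewrite -scalerAr -scalerAl epsM eqxx scalerA mulrC.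
    congr (_ + _).
      rewrite mulr_sumr; apply: eq_bigr => a _; rewrite mulr_suml.
      rewrite (bigD1 (tgt a)) //= big1 ?addr0; last first.
        move=> f fe; rewrite -scalerAr -scalerAl epsx (negPf fe).
        by rewrite !scaler0.
      by rewrite -scalerAr -scalerAl epsx eqxx scalerA mulrC.
    rewrite [X in _ + X](_ : _ = 0) ?addr0; last first.
      rewrite mulr_suml big1 // => a _; rewrite mulr_sumr big1 // => b _.
      by rewrite -scalerAr -scalerAl xx !scaler0.
    rewrite mulr_suml; apply: eq_bigr => a _; rewrite mulr_sumr.
    rewrite (bigD1 (src a)) //= big1 ?addr0; last first.
      move=> f fe; rewrite -scalerAr -scalerAl xeps eq_sym (negPf fe).
      by rewrite !scaler0.
    by rewrite -scalerAr -scalerAl xeps eqxx scalerA mulrC.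
  rewrite -big_split /=; congr (_ + _); apply: eq_bigr => i _.
    by rewrite radsq0_coef_mul.
  by rewrite radsq0_coef_mul scalerDl.
have F1 : F 1 = 1.
  rewrite /F [X in _ + X]big1 ?addr0.
    by rewrite -eps1; apply: eq_bigr => e _; rewrite radsq0_coef_one scale1r.
  by move=> a _; rewrite radsq0_coef_one scale0r.
have Fv e : F (radsq0_vtx e) = eps e.
  rewrite /F [X in _ + X]big1 ?addr0; last first.
    by move=> a _; rewrite radsq0_coef_vec scale0r.
  rewrite (bigD1 e) //= big1 ?addr0 ?radsq0_coef_vec ?eqxx ?scale1r // => f fe.
  by rewrite radsq0_coef_vec -[inl f == inl e]/(f == e) (negPf fe) scale0r.
have Fa a : F (radsq0_arr a) = xi a.
  rewrite /F [X in X + _]big1 ?add0r; last first.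
    by move=> e _; rewrite radsq0_coef_vec scale0r.
  rewrite (bigD1 a) //= big1 ?addr0 ?radsq0_coef_vec ?eqxx ?scale1r // => f fe.
  by rewrite radsq0_coef_vec -[inr f == inr a]/(f == a) (negPf fe) scale0r.
exists F; split=> // G [linG _ Gv Ga]; apply: funext => x.
pose Gl := GRing.isLinear.Build k radsq0 B *:%R G linG.
pose GL : {linear radsq0 -> B} := HB.pack G Gl.
rewrite -[G]/(GL : _ -> _) [in RHS](radsq0_decomp x) raddfD !raddf_sum /=.
congr (_ + _); apply: eq_bigr => i _; rewrite -[G]/(GL : _ -> _) linearZ /=.
  by rewrite -Gv.
by rewrite -Ga.
Qed.

End RadicalSquareZero.

(* Hochschild cohomology of A = kQ/<Q_2>, by the bar complex.                 *)
(* An element of Hom_k(A^{(x)n}, A) is a k-multilinear f : n.-tuple A -> A.   *)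

Section Hochschild.
Variables (k : fieldType) (Q : quiver).
Local Notation A := (radsq0 k Q).

(* The tuple with the entries of s; only used on sequences of size n. *)
Definition seq_tuple n (s : seq A) : n.-tuple A := [tuple s`_i | i < n].

Definition multilinear n (f : n.-tuple A -> A) : Prop :=
  forall (i : 'I_n) (t : n.-tuple A) (c : k) (x y : A),
    let ins z := [tuple if j == i then z else tnth t j | j < n] in
    f (ins (c *: x + y)) = c *: f (ins x) + f (ins y).

Definition hoch_d n (f : n.-tuple A -> A) (t : n.+1.-tuple A) : A :=
    t`_0 * f (seq_tuple n (drop 1 t))
  + \sum_(i < n) (-1) ^+ i.+1 *
      f (seq_tuple n (take i t ++ (t`_i * t`_i.+1) :: drop i.+2 t))
  + (-1) ^+ n.+1 * (f (seq_tuple n (take n t)) * t`_n).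

Definition cocycle_pred n : {pred n.-tuple A -> A} :=
  fun f => `[< multilinear f /\ (forall t, hoch_d f t = 0) >].

Definition coboundary n : (n.-tuple A -> A) -> Prop :=
  match n with
  | 0 => fun f => f = 0
  | m.+1 => fun f => exists2 g : m.-tuple A -> A,
              multilinear g & forall t, f t = hoch_d g t
  end.

Lemma multilinearP n a (f g : n.-tuple A -> A) :
  multilinear f -> multilinear g -> multilinear (a *: f + g).
Proof.
move=> mf mg i t c x y /=; have /= fE := mf i t c x y.
have /= gE := mg i t c x y; rewrite ![(a *: f + g) _]/(a *: f _ + g _) fE gE.
by rewrite !scalerDr !scalerA [c * a]mulrC addrACA.
Qed.

Lemma hoch_dP n (a : k) (f g : n.-tuple A -> A) t :
  hoch_d (a *: f + g) t = a *: hoch_d f t + hoch_d g t.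
Proof.
have E u : (a *: f + g) u = a *: f u + g u by [].
rewrite /hoch_d; under eq_bigr do rewrite E mulrDr -radsq0_scaleAr.
rewrite !E big_split /= -scaler_sumr !mulrDr mulrDl mulrDr.
rewrite -!radsq0_scaleAr -radsq0_scaleAl -radsq0_scaleAr !scalerDr.
by rewrite [X in X + (_ + _) = _]addrACA [LHS]addrACA.
Qed.

Lemma cocycle_submod n : submod_closed (@cocycle_pred n).
Proof.
have d0 t : hoch_d (0 : n.-tuple A -> A) t = 0.
  rewrite /hoch_d !mul0r !mulr0 addr0 add0r big1 // => i _.
  by rewrite mulr0.
split.
  apply/asboolP; split=> // i t c x y ins.
  by rewrite /= scaler0 addr0.
move=> a f g /asboolP[mf df] /asboolP[mg dg]; apply/asboolP; split.
  exact: multilinearP.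
by move=> t; rewrite hoch_dP df dg scaler0 addr0.
Qed.
HB.instance Definition _ n :=
  GRing.isSubmodClosed.Build k (n.-tuple A -> A) (@cocycle_pred n)
    (GRing.submod_closed_semi (@cocycle_submod n)).

Record cocycle n := Cocycle {
  cocycle_fun :> n.-tuple A -> A;
  cocycleP : cocycle_fun \in @cocycle_pred n
}.
HB.instance Definition _ n := [isSub for @cocycle_fun n].
HB.instance Definition _ n := [Choice of cocycle n by <:].
HB.instance Definition _ n := [SubChoice_isSubLmodule of cocycle n by <:].

Definition coboundary_pred n : {pred cocycle n} :=
  fun f => `[< coboundary (f : n.-tuple A -> A) >].

Lemma coboundary_submod n : submod_closed (@coboundary_pred n).
Proof.
split.
  apply/asboolP; case: n => [|n] /=; first by [].
  exists 0; first by move=> i t c x y ins; rewrite /= scaler0 addr0.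
  move=> t; rewrite /hoch_d !mul0r !mulr0 addr0 add0r big1 // => i _.
  by rewrite mulr0.
case: n => [|n] a f g /asboolP/= fB /asboolP/= gB; apply/asboolP => /=.
  by rewrite fB gB scaler0 addr0.
case: fB gB => [f' mf fE] [g' mg gE]; exists (a *: f' + g').
  exact: multilinearP.
by move=> t; rewrite hoch_dP -fE -gE.
Qed.
HB.instance Definition _ n :=
  GRing.isSubmodClosed.Build k (cocycle n) (@coboundary_pred n)
    (GRing.submod_closed_semi (@coboundary_submod n)).

Definition HH n := lquot (@coboundary_pred n).
HB.instance Definition _ n := GRing.Lmodule.on (HH n).

(* f is a cocycle whose class is x *)
Definition represents n (f : n.-tuple A -> A) (x : HH n) : Prop :=
  exists2 z : cocycle n, z = f :> (n.-tuple A -> A) & lclass _ z = x.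

(* Gerstenhaber bracket of cochains of degrees n, m >= 1.  The products are   *)
(* evaluated on sequences, which are meant to be of size n + m - 1; the index *)
(* i starts at 0. *)
Definition gcirc_at n m (i : nat) (f : n.-tuple A -> A) (g : m.-tuple A -> A)
    (s : seq A) : A :=
  f (seq_tuple n (take i s ++ g (seq_tuple m (take m (drop i s))) :: drop (i + m) s)).

Definition gcirc n m (f : n.-tuple A -> A) (g : m.-tuple A -> A)
    (s : seq A) : A :=
  \sum_(i < n) (-1) ^+ (i * m.-1) * gcirc_at i f g s.

Definition gbracket n m (f : n.-tuple A -> A) (g : m.-tuple A -> A)
    (t : (n + m).-1.-tuple A) : A :=
  gcirc f g t - (-1) ^+ (n.-1 * m.-1) * gcirc g f t.

End Hochschild.

Section Parallel.
Variables (k : fieldType) (Q : quiver).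

(* s = a_1 ... a_n is a path ending at e. *)
Fixpoint is_path (e : vtx Q) (s : seq (arr Q)) : bool :=
  if s is a :: s' then (tgt a == e) && is_path (src a) s' else true.

(* Q_n.  A path is recorded with its end, so that Q_0 is the set of vertices. *)
Definition qpath n := {p : vtx Q * n.-tuple (arr Q) | is_path p.1 p.2}.

Definition arrows n (p : qpath n) : n.-tuple (arr Q) := (val p).2.
Definition ptgt n (p : qpath n) : vtx Q := (val p).1.
Definition psrc n (p : qpath n) : vtx Q := last (ptgt p) (map (@src Q) (arrows p)).
Definition arrow_of (p : qpath 1) : arr Q := thead (arrows p).

(* Q_n || Q_m and k(Q_n || Q_m) *)
Definition par n m := {p : qpath n * qpath m |
  (psrc p.1 == psrc p.2) && (ptgt p.1 == ptgt p.2)}.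
Definition kpar n m := {ffun par n m -> k^o}.
HB.instance Definition _ n m := Vector.on (kpar n m).

Definition par1 n m (q : par n m) : qpath n := (val q).1.
Definition par2 n m (q : par n m) : qpath m := (val q).2.

(* The basis vector (al, y) of k(Q_n || Q_1), for n >= 1; it is 0 if al is    *)
(* not a path parallel to y.                                                  *)
Definition kpar_vec n (al : n.-tuple (arr Q)) (y : arr Q) : kpar n 1 :=
  [ffun q => ((arrows (par1 q) == al) && (arrow_of (par2 q) == y))%:R].

Definition parD n (w : kpar n 0) : kpar n.+1 1 :=
  \sum_(q : par n 0) (w : {ffun _ -> _}) q *:
    (let g := arrows (par1 q) in let e := ptgt (par2 q) in
       \sum_(a | src a == e) kpar_vec [tuple of a :: g] a
     + (-1) ^+ n.+1 *: \sum_(a | tgt a == e) kpar_vec [tuple of rcons g a] a).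

Lemma parD_is_linear n : linear (@parD n).
Proof.
move=> c u v; rewrite /parD scaler_sumr -big_split /=; apply: eq_bigr => q _.
by rewrite !ffunE scalerDl scalerA.
Qed.
HB.instance Definition _ n :=
  GRing.isLinear.Build k (kpar n 0) (kpar n.+1 1) *:%R (@parD n)
    (@parD_is_linear n).

(* Im D_{n-1} *)
Definition imD n : {vspace kpar n 1} :=
  if n is m.+1 then limg (linfun (@parD m)) else 0%VS.

Definition kpar_quot n := lquot (pred_of_vspace (imD n)).
HB.instance Definition _ n := GRing.Lmodule.on (kpar_quot n).
Definition kpar_class n (u : kpar n 1) : kpar_quot n :=
  lclass (pred_of_vspace (imD n)) u.

(* The cochain x_1 (x) ... (x) x_n |-> f (pi x_1 (x)_E ... (x)_E pi x_n) of   *)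
(* the combination v: since r^{(x)_E n} has the paths of length n as a basis, *)
(* the coordinate on al = a_1 ... a_n of pi x_1 (x)_E ... (x)_E pi x_n is the *)
(* product of the coordinates of the x_i on the a_i.                          *)
Definition par_cochain n (v : kpar n 1) (t : n.-tuple (radsq0 k Q)) :
    radsq0 k Q :=
  \sum_(q : par n 1)
    ((v : {ffun _ -> _}) q *
     \prod_(i < n) radsq0_coef (tnth t i) (inr (tnth (arrows (par1 q)) i))) *:
    radsq0_arr k (arrow_of (par2 q)).

(* al with its i-th arrow replaced by a *)
Definition replace_arrow n (al : n.-tuple (arr Q)) (i : 'I_n) (a : arr Q) :
    n.-tuple (arr Q) :=
  [tuple if j == i then a else tnth al j | j < n].

(* (a, x).(al, y) *)
Definition act_basis n (a x : arr Q) (al : n.-tuple (arr Q)) (y : arr Q) :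
    kpar n 1 :=
  (y == a)%:R *: kpar_vec al x
  - \sum_(i < n) (x == tnth al i)%:R *: kpar_vec (replace_arrow al i a) y.

Definition par_act n (u : kpar 1 1) (v : kpar n 1) : kpar n 1 :=
  \sum_(p : par 1 1) \sum_(q : par n 1)
    ((u : {ffun _ -> _}) p * (v : {ffun _ -> _}) q) *:
    act_basis (arrow_of (par1 p)) (arrow_of (par2 p))
              (arrows (par1 q)) (arrow_of (par2 q)).

End Parallel.

(* Main.v *)
Require Import Defs.
From HB Require Import structures.
From mathcomp Require Import all_boot all_order all_algebra.
From mathcomp Require Import boolp functions.
From mathcomp Require Import ring.
Set Implicit Arguments.
Unset Strict Implicit.
Unset Printing Implicit Defensive.
Import GRing.Theory.
Local Open Scope ring_scope.

(** Write A for kQ/<Q_2>, E for its subalgebra spanned by the vertices and dif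
    for the Hochschild differential. The cohomology of A is computed by
    restricting a cochain f of degree n to the paths of length n: its
    coefficients along parallel arrows form an element [res_arr f] of
    k(Q_n || Q_1), those along parallel vertices an element [res_vtx f] of
    k(Q_n || Q_0). On a path all products of consecutive arrows vanish, only
    the two outer terms of the differential survive, and therefore res_arr (dif
    f) = parD (res_vtx f), see [res_arr_dif]. In the other direction
    [par_cochain] takes values in cocycles and is a section of [res_arr]; it
    sends the image of parD to coboundaries.

    Two facts make these maps inverse to each other on cohomology. Since E is
    separable, every cocycle is cohomologous to one that vanishes as soon as
    one of its arguments is a vertex ([normalize_cocycle]); such a cocycle is
    E-balanced and hence determined by its values on paths, and these only
    involve vertices and arrows parallel to the path. Moreover, parD is
    injective in positive degrees ([parD_inj]): it kills the vertex part of a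
    normalized cocycle, which is thus zero. Together, a cocycle f is
    cohomologous to par_cochain (res_arr f) ([cocycle_decomp]), and the class
    of any cocycle can be read off on paths, modulo the image of parD.

    For the bracket, let f be a cocycle of degree 1, that is, a derivation of
    A. Then [f, g] is the Lie derivative of g along f, which commutes with dif
    ([dif_lie]). So [f, g] is a cocycle, and adding dif h to g adds to res_arr
    [f, g] an element of the image of parD. Adding an inner derivation to f
    does not change res_arr [f, par_cochain v] at all, because an inner
    derivation multiplies each arrow by the difference of the values of one
    function at its source and at its end, and these differences telescope
    along a path and along the arrow parallel to it ([lie_inner]). It remains
    to evaluate the Lie derivative of the chosen representatives on paths,
    which yields the formula of the theorem ([res_arr_lie_par_seq]). *)

(** * The Hochschild differential of a bimodule *)

Section Bimodule.
Variables (k : fieldType) (Q : quiver).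
Local Notation A := (radsq0 k Q).

(** The unit of A need not act as the identity on the left: dimension shifting
    leads to bimodules where it does not, and where the left action is not
    linear in A. *)
Record bimodule := Bimodule {
  bim_sort :> lmodType k;
  lact : A -> bim_sort -> bim_sort;
  ract : bim_sort -> A -> bim_sort;
  lactA : forall x y m, lact (x * y) m = lact x (lact y m);
  ractA : forall m x y, ract m (x * y) = ract (ract m x) y;
  lactrA : forall x m y, lact x (ract m y) = ract (lact x m) y;
  lact_lin : forall x, linear (lact x);
  ract_linl : forall y, linear (ract^~ y);
  ract_linr : forall m, linear (ract m)
}.

HB.instance Definition _ (M : bimodule) x :=
  GRing.isLinear.Build k M M *:%R (@lact M x) (@lact_lin M x).

Definition ractl (M : bimodule) y : M -> M := (@ract M)^~ y.
HB.instance Definition _ (M : bimodule) y :=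
  GRing.isLinear.Build k M M *:%R (@ractl M y) (@ract_linl M y).

Section BimoduleTheory.
Variable M : bimodule.
Implicit Types (m : M) (x y : A).

Lemma lactD x m m' : lact x (m + m') = lact x m + lact x m'.
Proof. exact: linearD. Qed.
Lemma ract0 y : ract (0 : M) y = 0.
Proof. exact: (linear0 (ractl y)). Qed.
Lemma ractN m y : ract (- m) y = - ract m y.
Proof. exact: (linearN (ractl y)). Qed.

(** The Hochschild differential without its leading term. Once the product of
    the first two arguments is split off, the other terms are those of the
    cochain with its first argument frozen, with the opposite sign; this
    recursion on lists replaces the alternating sum over positions. *)
Fixpoint tail_dif (F : seq A -> M) (s : seq A) : M :=
  if s is x :: s' then
    if s' is y :: r then - F (x * y :: r) - tail_dif (fun r => F (x :: r)) s'
    else - ract (F [::]) x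
  else 0.

Definition dif (F : seq A -> M) (s : seq A) : M :=
  if s is x :: s' then lact x (F s') + tail_dif F s else 0.

Lemma tail_dif2 F x y s :
  tail_dif F [:: x, y & s] =
  - F (x * y :: s) - tail_dif (fun r => F (x :: r)) (y :: s).
Proof. by []. Qed.

Lemma tail_dif_ext F G s :
  (forall r, (size r).+1 = size s -> F r = G r) -> tail_dif F s = tail_dif G s.
Proof.
elim: s F G => [//|x [|y s] IH] F G eFG; first by rewrite /= eFG.
rewrite !tail_dif2 eFG //; congr (_ - _); apply: IH => r sr.
by apply: eFG; rewrite /= sr.
Qed.

Lemma dif_ext F G s :
  (forall r, (size r).+1 = size s -> F r = G r) -> dif F s = dif G s.
Proof.
case: s => [//|x s] eFG; rewrite /dif eFG //; congr (_ + _).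
exact: tail_dif_ext.
Qed.

(** Evaluation at s, named so that it can carry a linear structure. *)
Definition tail_dif_at s F := tail_dif F s.
Lemma tail_dif_linear s : linear (tail_dif_at s).
Proof.
rewrite /tail_dif_at; elim: s => [|x [|y s] IH] c F G;
  first by rewrite scaler0 addr0.
  by rewrite /= ract_linl opprD scalerN.
rewrite !tail_dif2.
rewrite -[fun r => (c *: F + G) (x :: r)]/(c *: (fun r => F (x :: r)) +
  (fun r => G (x :: r))) IH !opprD addrACA scalerBr.
by rewrite -!scalerN -opprD.
Qed.
HB.instance Definition _ s :=
  GRing.isLinear.Build k (seq A -> M) M *:%R (tail_dif_at s) (tail_dif_linear s).
Lemma tail_difP c F G s :
  tail_dif (c *: F + G) s = c *: tail_dif F s + tail_dif G s.
Proof. exact: (linearP (tail_dif_at s)). Qed.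
Lemma tail_difZ c F s : tail_dif (c *: F) s = c *: tail_dif F s.
Proof. exact: (linearZ_LR (tail_dif_at s)). Qed.
Lemma tail_difD F G s : tail_dif (F + G) s = tail_dif F s + tail_dif G s.
Proof. exact: (linearD (tail_dif_at s)). Qed.
Lemma tail_difN F s : tail_dif (- F) s = - tail_dif F s.
Proof. exact: (linearN (tail_dif_at s)). Qed.
Lemma tail_dif0 s : tail_dif 0 s = 0.
Proof. exact: (linear0 (tail_dif_at s)). Qed.

Definition dif_at s F := dif F s.
Lemma dif_linear s : linear (dif_at s).
Proof.
rewrite /dif_at; case: s => [|x s] c F G; first by rewrite scaler0 addr0.
rewrite /dif -[tail_dif _ _]/(tail_dif_at _ _) linearP.
by rewrite linearP /= scalerDr addrACA.
Qed.
HB.instance Definition _ s :=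
  GRing.isLinear.Build k (seq A -> M) M *:%R (dif_at s) (dif_linear s).
Lemma difB F G s : dif (F - G) s = dif F s - dif G s.
Proof. exact: (linearB (dif_at s)). Qed.

Lemma tail_dif_lact x F s : tail_dif (fun r => lact x (F r)) s =
  lact x (tail_dif F s).
Proof.
elim: s F => [|y [|z s] IH] F; first by rewrite linear0.
  by rewrite /= linearN /= lactrA.
by rewrite !tail_dif2 IH linearB linearN.
Qed.

(** This is dif (dif F) = 0 for the zero left action. Freezing the first
    argument x of tail_dif F gives - F1 - F2, where F1 contains the product of
    x with the next argument; F2 is killed by induction, and F1 cancels the
    remaining term by associativity. *)
Lemma tail_dif_tail_dif F s : tail_dif (tail_dif F) s = 0.
Proof.
elim: s F => [//|x [|y s] IH] F; first by rewrite /= ract0 oppr0.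
rewrite tail_dif2; case: s IH => [|z s] IH; first by rewrite /=
  ractN ractA !opprK subrr.
pose F1 r := if r is u :: r' then F (x * u :: r') else 0.
pose F2 := tail_dif (fun t => F (x :: t)).
rewrite [X in _ - X](@tail_dif_ext _ (- F1 - F2)) => [|[|u r]] //.
rewrite tail_difD !tail_difN [tail_dif F2 _]IH subr0 !tail_dif2.
by rewrite /F1 mulrA [X in _ + X]opprK addNr.
Qed.

Lemma dif_dif F s : dif (dif F) s = 0.
Proof.
case: s => [//|x [|y s]]; first by rewrite /= ract0 linear0 oppr0 addr0.
rewrite {1}/dif tail_dif2.
rewrite -[fun r => dif F _]/((fun r => lact x (F r)) +
  (fun r => tail_dif F (x :: r))).
rewrite tail_difD tail_dif_lact /dif lactD -lactA.
have /eqP := tail_dif_tail_dif F [:: x, y & s].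
rewrite tail_dif2 -opprD oppr_eq0 addr_eq0 => /eqP ->.
by rewrite !opprD opprK [X in _ + X]addrACA subrr addr0 -opprD subrr.
Qed.

End BimoduleTheory.
End Bimodule.

(** * Dimension shifting *)

Section Hom.
Variables (k : fieldType) (Q : quiver).
Local Notation A := (radsq0 k Q).
Local Notation bimodule := (bimodule k Q).
Variable M : bimodule.

Let lhom (y : A) (f : A -> M) : A -> M := fun x => f (x * y) - lact x (f y).
Let rhom (f : A -> M) (y : A) : A -> M := fun x => ract (f x) y.

Fact lhomA x y f : lhom (x * y) f = lhom x (lhom y f).
Proof.
apply: funext => z; rewrite /lhom linearB /= lactA mulrA.
by rewrite opprB addrA subrK.
Qed.
Fact rhomA f x y : rhom f (x * y) = rhom (rhom f x) y.
Proof. by apply: funext => z; rewrite /rhom ractA. Qed.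
Fact lrhomA x f y : lhom x (rhom f y) = rhom (lhom x f) y.
Proof.
by apply: funext => z; rewrite /rhom /lhom lactrA -(linearB (ractl y)).
Qed.
Fact lhom_lin x : linear (lhom x).
Proof.
move=> c f g; apply: funext => z; rewrite /lhom.
rewrite ![(c *: f + g) _]/(c *: f _ + g _) linearP /= opprD addrACA.
by rewrite -scalerN -scalerDr.
Qed.
Fact rhom_linl y : linear (rhom^~ y).
Proof. by move=> c f g; apply: funext => z; apply: ract_linl. Qed.
Fact rhom_linr f : linear (rhom f).
Proof. by move=> c x y; apply: funext => z; apply: ract_linr. Qed.

(** Hom(A, M) with the actions for which cochains with values in M are, one
    degree lower and up to sign, cochains with values in Hom(A, M). The unit
    sends f to the function x |-> f x - x (f 1). *)
Definition hom_bimodule : bimodule :=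
  Bimodule lhomA rhomA lrhomA lhom_lin rhom_linl rhom_linr.

Definition curry (F : seq A -> M) : seq A -> hom_bimodule := fun s x => F (x :: s).

Lemma tail_dif_hom (G : seq A -> hom_bimodule) s x :
  tail_dif G s x = tail_dif (fun r => G r x) s.
Proof.
elim: s G => [//|y [//|z s] IH] G.
rewrite (tail_dif2 G) (tail_dif2 (fun r => G r x)).
by rewrite -(IH (fun r => G (y :: r))).
Qed.

(** Inductions on the degree of a cochain pass through this formula: they are
    run for all bimodules at once. *)
Lemma dif_curry F x y s :
  dif F [:: x, y & s] = - dif (curry F) (y :: s) x.
Proof.
rewrite [dif (curry F) _ _]/(lact y (curry F s) x + tail_dif (curry F) (y :: s) x)
  tail_dif_hom.
rewrite [lact y (curry F s) x]/(F (x * y :: s) - lact x (F (y :: s))) /dif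
  tail_dif2.
by rewrite opprD opprB addrA.
Qed.
End Hom.

(** * Multilinear cochains *)

Section Multilinear.
Variables (k : fieldType) (Q : quiver).
Local Notation A := (radsq0 k Q).
Variable V : lmodType k.
Implicit Types F G : seq A -> V.

Fixpoint mlin n F : Prop :=
  if n is m.+1 then
    (forall s, size s = m -> linear (fun x => F (x :: s)))
    /\ forall x, mlin m (fun s => F (x :: s))
  else True.

Lemma mlin_ext n F G :
  (forall s, size s = n -> F s = G s) -> mlin n F -> mlin n G.
Proof.
elim: n F G => [//|n IH] F G eFG [linF mF]; split=> [s sn c x y|x].
  by rewrite -!eFG /= ?sn //; apply: linF.
by apply: IH (mF x) => s sn; apply: eFG; rewrite /= sn.
Qed.

Lemma mlinP n c F G : mlin n F -> mlin n G -> mlin n (c *: F + G).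
Proof.
elim: n F G => [//|n IH] F G [linF mF] [linG mG]; split=> [s sn d x y|x].
  rewrite ![(c *: F + G) _]/(c *: F _ + G _) linF // linG //.
  by rewrite !scalerDr !scalerA [c * d]mulrC addrACA.
exact: IH (mF x) (mG x).
Qed.

Lemma mlin0 n : mlin n (0 : seq A -> V).
Proof. by elim: n => [//|n IH]; split=> // s _ c x y; rewrite /= scaler0 addr0. Qed.

Lemma mlinZ n c F : mlin n F -> mlin n (c *: F).
Proof. by move=> mF; rewrite -[c *: F]addr0; apply: mlinP (mlin0 n). Qed.
Lemma mlinN n F : mlin n F -> mlin n (- F).
Proof.
move=> mF; apply: mlin_ext (mlinP (-1) mF (mlin0 n)) => s _.
by rewrite addr0 scaleN1r.
Qed.
Lemma mlinB n F G : mlin n F -> mlin n G -> mlin n (F - G).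
Proof.
move=> mF mG; apply: mlin_ext (mlinP 1 mF (mlinN mG)) => s _.
by rewrite scale1r.
Qed.
Lemma mlin_sum n I (r : seq I) (P : pred I) (F : I -> seq A -> V) :
  (forall i, mlin n (F i)) -> mlin n (\sum_(i <- r | P i) F i).
Proof.
move=> mF; apply: big_ind => [|f g mf mg|//]; first exact: mlin0.
by apply: mlin_ext (mlinP 1 mf mg) => s _; rewrite scale1r.
Qed.

Lemma mlin_at n F p x y c s : mlin n F -> (size p + (size s).+1)%N = n ->
  F (p ++ (c *: x + y) :: s) = c *: F (p ++ x :: s) + F (p ++ y :: s).
Proof.
elim: n F p => [|n IH] F [|z p]; rewrite ?addnS //= => -[linF mF] [sn].
  exact: linF.
by apply: (IH (fun s => F (z :: s)) p (mF z)); rewrite addnS.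
Qed.

End Multilinear.

Section MultilinearBimodule.
Variables (k : fieldType) (Q : quiver).
Local Notation A := (radsq0 k Q).
Local Notation bimodule := (bimodule k Q).
Variable M : bimodule.
Implicit Types F : seq A -> M.

Lemma mlin_curry n F : mlin n.+1 F -> mlin n (curry F).
Proof.
elim: n F => [//|n IH] F [linF mF]; split=> [s sn c x y|x].
  by apply: funext => z; have [linFz _] := mF z; apply: linFz.
(* With x frozen in the second place, F is curried in its first argument. *)
apply: (IH (fun s => if s is y :: r then F [:: y, x & r] else 0)).
split=> [s sn c y z /=|y]; first by apply: linF; rewrite /= sn.
by have [_ mFy] := mF y; apply: mFy.
Qed.

Lemma mlin_tail_dif n F : mlin n F -> mlin n.+1 (tail_dif F).
Proof.
elim: n F => [|n IH] F; first by split=> // -[] //= _ c x y;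
  rewrite ract_linr opprD scalerN.
move=> [linF mF]; split=> [[//|y s] [sn] c x z|x].
  rewrite !tail_dif2 mulrDl -radsq0_scaleAl linF //.
  have -> : tail_dif (fun r => F ((c *: x + z) :: r)) (y :: s)
      = tail_dif (c *: (fun r => F (x :: r)) + (fun r => F (z :: r))) (y :: s).
    by apply: tail_dif_ext => r [rs]; apply: linF; rewrite rs.
  by rewrite tail_difP !opprD addrACA scalerBr scalerN.
have mG : mlin n.+1 (fun s => if s is y :: r then F (x * y :: r) else 0).
  split=> [s sn c y z /=|y]; last exact: mF.
  by rewrite mulrDr -radsq0_scaleAr linF.
apply: mlin_ext (mlinB (mlinN mG) (IH _ (mF x))) => -[//|y s] _.
by rewrite tail_dif2.
Qed.

End MultilinearBimodule.

(** * Normalization relative to the vertices *)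

Lemma linear_fun_sum (k : fieldType) (U V : lmodType k) (f : U -> V) I (r : seq I)
    (F : I -> U) : linear f -> f (\sum_(i <- r) F i) = \sum_(i <- r) f (F i).
Proof.
move=> lf; pose fL : {linear U -> V} :=
  HB.pack f (GRing.isLinear.Build k U V *:%R f lf).
exact: (raddf_sum fL).
Qed.
Lemma linear_fun0 (k : fieldType) (U V : lmodType k) (f : U -> V) : linear f ->
  f 0 = 0.
Proof.
move=> lf; pose fL : {linear U -> V} :=
  HB.pack f (GRing.isLinear.Build k U V *:%R f lf).
exact: (linear0 fL).
Qed.

Section Normalization.
Variables (k : fieldType) (Q : quiver).
Local Notation A := (radsq0 k Q).
Local Notation bimodule := (bimodule k Q).
Local Notation vtxA e := (radsq0_vtx k e).

Lemma vtx_idem (e : vtx Q) : vtxA e * vtxA e = vtxA e.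
Proof. by rewrite radsq0_vecM /= eqxx. Qed.
Lemma vtx_orth (e f : vtx Q) : e != f -> vtxA e * vtxA f = 0.
Proof. by move=> /negPf ef; rewrite radsq0_vecM /= ef. Qed.
Lemma sum_vtx : \sum_e vtxA e = 1 :> A.
Proof. by []. Qed.

(** The conditions on the values of a cochain that allow averaging over the
    vertices: on P, though not necessarily on M, the left action is unital and
    linear in A. *)
Record unital_sub (M : bimodule) (P : M -> Prop) : Prop := UnitalSub {
  unital0 : P 0;
  unitalP : forall c m m', P m -> P m' -> P (c *: m + m');
  unital_lact : forall x m, P m -> P (lact x m);
  unital_ract : forall m x, P m -> P (ract m x);
  unital_lact_lin : forall m, P m -> linear (fun x => lact x m);
  unital_lact1 : forall m, P m -> lact 1 m = m
}.

Definition normalized (V : lmodType k) n (F : seq A -> V) : Prop :=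
  forall p e s, (size p + (size s).+1)%N = n -> F (p ++ vtxA e :: s) = 0.

Definition is_cocycle (M : bimodule) n (F : seq A -> M) : Prop :=
  forall s, size s = n.+1 -> dif F s = 0.

Definition bounds (M : bimodule) (P : M -> Prop) n (B : seq A -> M) : Prop :=
  if n is m.+1 then
    exists H, [/\ mlin m H, forall s, size s = m -> P (H s) &
                  forall s, size s = m.+1 -> B s = dif H s]
  else forall s, size s = 0%N -> B s = 0.

Section Sub.
Variables (M : bimodule) (P : M -> Prop).
Hypothesis PU : unital_sub P.

Lemma unitalD m m' : P m -> P m' -> P (m + m').
Proof. by move=> Pm Pm'; rewrite -[m]scale1r; apply: (unitalP PU). Qed.
Lemma unitalN m : P m -> P (- m).
Proof. by move=> Pm; rewrite -scaleN1r -[_ *: _]addr0; apply: (unitalP PU) => //;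
  apply: (unital0 PU). Qed.
Lemma unital_sum I (r : seq I) (F : I -> M) :
  (forall i, P (F i)) -> P (\sum_(i <- r) F i).
Proof. by move=> PF; apply: big_ind => //;
  [apply: (unital0 PU) | apply: unitalD]. Qed.

Lemma sum_lact_vtx m : P m -> \sum_e lact (vtxA e) m = m.
Proof.
move=> Pm; rewrite -(linear_fun_sum _ (fun e => vtxA e) (unital_lact_lin PU Pm)).
by rewrite sum_vtx (unital_lact1 PU).
Qed.

Lemma unital_tail_dif n (F : seq A -> M) s :
  (forall r, size r = n -> P (F r)) -> size s = n.+1 -> P (tail_dif F s).
Proof.
elim: s n F => [//|x [|y s] IH] n F PF [sn].
  by apply: unitalN; apply: (unital_ract PU); apply: PF.
case: n => [//|n] in PF sn *; rewrite tail_dif2; apply: unitalD; apply: unitalN.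
  by apply: PF.
by apply: (IH n) => // r rn; apply: PF; rewrite /= rn.
Qed.

Lemma unital_dif n (F : seq A -> M) s :
  (forall r, size r = n -> P (F r)) -> size s = n.+1 -> P (dif F s).
Proof.
case: s => [//|x s] PF sn; apply: unitalD; last exact: (unital_tail_dif PF sn).
by apply: (unital_lact PU); apply: PF; case: sn.
Qed.

Lemma mlin_lact n (F : seq A -> M) x : mlin n F -> mlin n (fun s => lact x (F s)).
Proof.
elim: n F => [//|n IH] F [linF mF]; split=> [s sn c y z|y];
  last exact: (IH _ (mF y)).
by rewrite linF // linearP.
Qed.

Lemma mlin_dif n (F : seq A -> M) :
  (forall r, size r = n -> P (F r)) -> mlin n F -> mlin n.+1 (dif F).
Proof.
move=> PF mF; have [linT mT] := mlin_tail_dif mF; split=> [s sn c x y|x].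
  rewrite /dif linT // (unital_lact_lin PU) ?scalerDr 1?addrACA //; exact: PF.
have mx := mlin_lact x mF; have := mlinP 1 mx (mT x).
by apply: mlin_ext => s sn; rewrite scale1r.
Qed.

(** The properties that normalization of the first argument of a cocycle gives
    to the cocycle as a function of this argument. *)
Definition hom_sub (f : hom_bimodule M) : Prop :=
  [/\ linear f, forall x, P (f x), forall e, f (vtxA e) = 0 &
      forall e x, f (vtxA e * x) = lact (vtxA e) (f x)].

(** The unit acts as the identity since f 1 is the sum of the f e = 0. *)
Lemma unital_hom_sub : unital_sub hom_sub.
Proof.
have E c (f g : hom_bimodule M) z : (c *: f + g) z = c *: f z + g z by [].
have El y (f : hom_bimodule M) x : lact y f x = f (x * y) - lact x (f y) by [].
have Er y (f : hom_bimodule M) x : ract f y x = ract (f x) y by [].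
split.
- split=> [c x y|x|//|e x]; rewrite ?scaler0 ?addr0 //; first exact: (unital0 PU).
  by rewrite [RHS]linear0.
- move=> c f g [lf Pf f0 fe] [lg Pg g0 ge]; split=> [d x y|x|e|e x]; rewrite !E.
  + by rewrite lf lg !scalerDr !scalerA [c * d]mulrC addrACA.
  + exact: (unitalP PU).
  + by rewrite f0 g0 scaler0 addr0.
  + by rewrite fe ge linearP.
- move=> y f [lf Pf f0 fe]; split=> [c x z|x|e|e x]; rewrite !El.
  + rewrite mulrDl -radsq0_scaleAl lf (unital_lact_lin PU) //.
    by rewrite opprD addrACA scalerBr.
  + by apply: unitalD => //; apply: unitalN; apply: (unital_lact PU).
  + by rewrite fe subrr.
  + by rewrite -mulrA fe lactA -linearB.
- move=> f y [lf Pf f0 fe]; split=> [c x z|x|e|e x]; rewrite !Er.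
  + by rewrite lf ract_linl.
  + exact: (unital_ract PU).
  + by rewrite f0 ract0.
  + by rewrite fe lactrA.
- move=> f [lf Pf f0 fe] c y z; apply: funext => x; rewrite E !El.
  rewrite mulrDr -radsq0_scaleAr !lf linearP /= opprD addrACA.
  by rewrite -scalerN -scalerDr.
- move=> f [lf Pf f0 fe]; apply: funext => x; rewrite El mulr1.
  rewrite -sum_vtx (linear_fun_sum _ (fun e => vtxA e) lf) big1 ?linear0 ?oppr0
    ?addr0 //.
Qed.
End Sub.

(** In the cocycle identity at e, x, s, the terms that keep e as a separate
    argument vanish, and only e F(x, s) and F(e x, s) remain. *)
Lemma cocycle_lact_vtx n (M : bimodule) (F : seq A -> M) e x s :
    is_cocycle n.+1 F -> (forall r, size r = n -> F (vtxA e :: r) = 0) ->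
    size s = n ->
  F (vtxA e * x :: s) = lact (vtxA e) (F (x :: s)).
Proof.
move=> cF F0 sn; have := cF [:: vtxA e, x & s]; rewrite /= sn => /(_ erefl) /eqP.
rewrite -[_ + _]/(lact _ _ + tail_dif F [:: _, _ & _]) tail_dif2.
rewrite (@tail_dif_ext _ _ _ (fun r => F (vtxA e :: r)) 0) ?tail_dif0 => [|r [rs]].
  by rewrite subr0 subr_eq0 eq_sym => /eqP.
by apply: F0; rewrite rs.
Qed.

Lemma cocycle_curry n (M : bimodule) (F : seq A -> M) :
  is_cocycle n.+1 F -> is_cocycle n (curry F).
Proof.
move=> cF [//|y s] [sn]; apply: funext => x; apply/eqP; rewrite -oppr_eq0.
by rewrite -dif_curry cF //= sn.
Qed.

Lemma mlin_eval n (M : bimodule) (F : seq A -> hom_bimodule M) x :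
  mlin n F -> mlin n (fun s => F s x).
Proof.
elim: n F => [//|n IH] F [linF mF]; split=> [s sn c y z|y]; last exact: IH (mF y).
by rewrite linF.
Qed.

(** The first argument is normalized by averaging with the separability
    idempotent of E: with H0 = sum_e e F(e, -), the sum over e of e times the
    cocycle identity at e, f, s says that F and dif H0 agree at f, s for every
    vertex f. The corrected cocycle G, as a function of its first argument, has
    values in hom_sub P, so that dimension shifting normalizes the other
    arguments without spoiling the first one. *)
Lemma normalize_cocycle n (M : bimodule) (P : M -> Prop) (F : seq A -> M) :
    unital_sub P -> (forall s, size s = n -> P (F s)) -> mlin n F ->
    is_cocycle n F ->
  exists2 B, bounds P n B & normalized n (F - B).
Proof.
elim: n M P F => [|n IH] M P F PU PF mF cF.
  by exists 0 => // p e s; rewrite addnS.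
pose H0 s := \sum_e lact (vtxA e) (F (vtxA e :: s)).
have PH0 s : size s = n -> P (H0 s).
  by move=> sn; apply: (unital_sum PU) => e; apply: (unital_lact PU); apply: PF;
    rewrite /= sn.
have mH0 : mlin n H0.
  have [_ mFx] := mF.
  have := mlin_sum (index_enum (vtx Q)) xpredT
    (fun e => mlin_lact (vtxA e) (mFx (vtxA e))).
  by apply: mlin_ext => s _; rewrite /H0 fct_sumE.
pose G := F - dif H0.
have PG s : size s = n.+1 -> P (G s).
  move=> sn; apply: unitalD => //; first exact: PF.
  by apply: unitalN => //; apply: (unital_dif PU PH0).
have mG : mlin n.+1 G by apply: mlinB => //; apply: (mlin_dif PU PH0).
have cG : is_cocycle n.+1 G.
  by move=> s sn; rewrite /G difB dif_dif cF // subrr.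
have tail_H0 s : tail_dif H0 s =
  \sum_e lact (vtxA e) (tail_dif (fun r => F (vtxA e :: r)) s).
  have -> : H0 = \sum_e (fun s => lact (vtxA e) (F (vtxA e :: s))).
    by apply: funext => r; rewrite fct_sumE.
  rewrite -[LHS]/(tail_dif_at s _) raddf_sum; apply: eq_bigr => e _.
  exact: tail_dif_lact.
have [linF mFx] := mF; have [linG mGx] := mG.
have G0 f s : size s = n -> G (vtxA f :: s) = 0.
  move=> sn; apply/eqP; rewrite subr_eq0; apply/eqP.
  have := sum_lact_vtx PU (PF (vtxA f :: s) (congr1 succn sn)).
  have dF e : lact (vtxA e) (F (vtxA f :: s)) =
      F (vtxA e * vtxA f :: s) + tail_dif (fun r => F (vtxA e :: r)) (vtxA f :: s).
    have := cF [:: vtxA e, vtxA f & s]; rewrite /= sn => /(_ erefl)/eqP.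
    by rewrite -[_ + _]/(lact _ _ + tail_dif F [:: _, _ & _]) tail_dif2 -opprD
      subr_eq0 => /eqP.
  under eq_bigr do rewrite -[vtxA _ in X in lact X]vtx_idem lactA dF lactD.
  rewrite big_split -tail_H0 /= => <-; rewrite /dif; congr (_ + _).
  rewrite (bigD1 f) //= big1 ?addr0 => [|e ef]; last first.
    by rewrite vtx_orth // (linear_fun0 (linF s sn)) linear0.
  rewrite linear_sum (bigD1 f) //= big1 ?addr0 => [|e ef]; last first.
    by rewrite -lactA vtx_orth 1?eq_sym // (linear_fun0 (unital_lact_lin PU _))
      //; apply: PF; rewrite /= sn.
  by rewrite -lactA !vtx_idem.
have Ge e x s : size s = n -> G (vtxA e * x :: s) = lact (vtxA e) (G (x :: s)).
  by move=> sn; have := cocycle_lact_vtx x cG (G0 e) sn.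
have PG' s : size s = n -> hom_sub P (curry G s).
  move=> sn; split.
  - exact: linG.
  - by move=> x; apply: PG; rewrite /= sn.
  - by move=> e; apply: G0.
  - by move=> e x; apply: Ge.
have cG' := cocycle_curry cG.
have [B1 bB1 nB1] := IH _ _ _ (unital_hom_sub PU) PG' (mlin_curry mG) cG'.
pose B1' s : M := if s is x :: r then B1 r x else 0.
have B1e s e : size s = n -> B1 s (vtxA e) = 0.
  case: (n) bB1 => [B0 sn|m [H [_ PH B1H]] sm]; first by rewrite B0.
  rewrite B1H //.
  by have [] := unital_dif (unital_hom_sub PU) PH sm.
(* Uncurrying H1 changes the sign of its differential. *)
exists (dif H0 + B1').
  case: (n) bB1 mH0 PH0 => [B0|m [H [mH PH B1H]]] mH0 PH0.
    exists H0; split=> // -[//|x [|//]] _.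
    by rewrite -[LHS]/(dif H0 [:: x] + B1 [::] x) B0 // addr0.
  pose U s := if s is x :: r then H r x else 0.
  exists (H0 - U); split.
  - apply: mlinB => //; split=> [s sm|x]; last exact: mlin_eval.
    by have [] := PH s sm.
  - case=> [//|x s] [sm]; apply: unitalD => //; first by apply: PH0; rewrite /= sm.
    by apply: unitalN => //; have [_ Px _ _] := PH s sm; apply: Px.
  - case=> [//|x [//|y s]] [sm]; rewrite difB [dif U _]dif_curry opprK.
    by rewrite -[LHS]/(_ + B1 (y :: s) x) B1H /= ?sm.
case=> [|x p] e s /= [sn]; rewrite opprD addrA.
  by rewrite -[LHS]/(G (vtxA e :: s) - B1 s (vtxA e)) G0 // B1e // subr0.
by have /(congr1 (fun f => f x)) := nB1 p e s sn.
Qed.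
End Normalization.

(** * Normalized cocycles on paths *)

Arguments tail_dif : simpl never.

Section NormalizedCocycle.
Variables (k : fieldType) (Q : quiver).
Local Notation A := (radsq0 k Q).
Local Notation bimodule := (bimodule k Q).
Local Notation vtxA e := (radsq0_vtx k e).
Local Notation arrA a := (radsq0_arr k a).
Local Notation arrs s := (map (@radsq0_arr k Q) s).

Lemma vtx_arr e (a : arr Q) : vtxA e * arrA a = if tgt a == e then arrA a else 0.
Proof. by rewrite radsq0_vecM /= eq_sym; case: eqP. Qed.
Lemma arr_vtx (a : arr Q) e : arrA a * vtxA e = if src a == e then arrA a else 0.
Proof. by rewrite radsq0_vecM /=; case: eqP. Qed.
Lemma arr_arr (a b : arr Q) : arrA a * arrA b = 0.
Proof. by rewrite radsq0_vecM. Qed.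

Lemma normalized_curry (M : bimodule) n (F : seq A -> M) :
  normalized n.+1 F -> normalized n (curry F).
Proof.
move=> nF p e s sn; apply: funext => x.
by apply: (nF (x :: p)); rewrite /= addSn sn.
Qed.

(** A normalized cocycle is E-balanced. Indeed, for the coefficients Hom(A, M)
    the left action of a vertex on the curried cocycle amounts to multiplying
    the first argument by it on the right; so induction on the degree compares
    the source of each arrow with the end of the next one. *)
Lemma normalized_lact_vtx n (M : bimodule) (F : seq A -> M) e s :
    mlin n.+1 F -> normalized n.+1 F -> is_cocycle n.+1 F -> size s = n.+1 ->
  lact (vtxA e) (F (arrs s)) = if is_path e s then F (arrs s) else 0.
Proof.
elim: n M F e s => [|n IH] M F e [//|a s] mF nF cF [sn] /=;
  have [linF _] := mF; have F0 f r : size r = size s -> F (vtxA f :: r) = 0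
    by move=> rs; apply: (nF [::]); rewrite /= rs sn.
  rewrite -(cocycle_lact_vtx _ cF) ?size_map ?sn // ?vtx_arr => [|r r0]; last first.
    by apply: F0; rewrite r0 sn.
  case: s sn {F0} => // _; rewrite andbT; case: eqP => // _.
  by rewrite (linear_fun0 (linF [::] _)).
rewrite -(cocycle_lact_vtx _ cF) ?size_map ?sn // ?vtx_arr => [|r r0]; last first.
  by apply: F0; rewrite r0 sn.
case: eqP => [_ /=|_]; last by rewrite (linear_fun0 (linF (arrs s) _)) // size_map.
have := IH _ _ (src a) s (mlin_curry mF) (normalized_curry nF) (cocycle_curry cF)
  sn.
move=> /(congr1 (fun f => f (arrA a))).
rewrite -[LHS]/(F (_ :: arrs s) - lact _ (F (_ :: arrs s))).
by rewrite arr_vtx eqxx F0 ?size_map // linear0 subr0; case: (is_path _ _).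
Qed.

(** The induction ends with a cocycle of degree 0, that is, an element on which
    the left and the right action of a vertex agree. *)
Lemma normalized_ract_vtx n (M : bimodule) (F : seq A -> M) a s :
    normalized n.+1 F -> is_cocycle n.+1 F -> size s = n ->
  ract (F (arrs (a :: s))) (vtxA (src (last a s))) = F (arrs (a :: s)).
Proof.
elim: n M F a s => [|n IH] M F a s nF cF sn.
  case: s sn => // _.
  have := cocycle_curry cF (erefl (size [:: vtxA (src a)])).
  move=> /(congr1 (fun f => f (arrA a))) /eqP.
  rewrite -[X in X == _]/(F [:: _] - lact _ (F [:: _]) - ract (F [:: arrA a]) _).
  by rewrite arr_vtx eqxx (nF [::]) // linear0 subr0 subr_eq0 eq_sym => /eqP.
case: s sn => // b s [sn].
have := IH _ _ b s (normalized_curry nF) (cocycle_curry cF) sn.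
by move=> /(congr1 (fun f => f (arrA a))).
Qed.

(** The vertices and the arrows span A. *)
Lemma mlin_arr_eq0 n (V : lmodType k) (F : seq A -> V) :
    mlin n F -> normalized n F ->
    (forall s : seq (arr Q), size s = n -> F (arrs s) = 0) ->
  forall s, size s = n -> F s = 0.
Proof.
elim: n V F => [|n IH] V F mF nF aF [|x s] //= sn; first exact: (aF [::]).
have [linF mFx] := mF; case: sn => sn; have lF := linF s sn.
pose f : {linear A -> V} :=
  HB.pack (fun x => F (x :: s)) (GRing.isLinear.Build k A V *:%R _ lF).
rewrite -[LHS]/(f x) (radsq0_decomp x) raddfD !raddf_sum /=.
rewrite !big1 ?addr0 // => i _; rewrite -[LHS]/(f _) linearZ /=.
  rewrite (IH _ _ (mFx (arrA i))) ?scaler0 // => [p e r pr|r rn].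
    by apply: (nF (arrA i :: p)); rewrite /= addSn pr.
  by apply: (aF (i :: r)); rewrite /= rn.
by rewrite (nF [::]) ?scaler0 //= sn.
Qed.

Definition regular_bimodule : bimodule.
Proof.
refine (@Bimodule k Q A (fun x y => x * y) (fun x y => x * y) _ _ _ _ _ _).
- by move=> x y m; rewrite mulrA.
- by move=> x y m; rewrite mulrA.
- by move=> x y m; rewrite mulrA.
- by move=> x c y z; rewrite mulrDr radsq0_scaleAr.
- by move=> x c y z; rewrite mulrDl radsq0_scaleAl.
- by move=> x c y z; rewrite mulrDr radsq0_scaleAr.
Defined.

Lemma unital_regular : @unital_sub k Q regular_bimodule (fun=> True).
Proof.
split=> // [m _ c x y|m _]; last exact: mul1r.
by rewrite -[LHS]/((c *: x + y) * m) mulrDl -radsq0_scaleAl.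
Qed.
End NormalizedCocycle.

(** * The cochain of a path *)

Section PathCochain.
Variables (k : fieldType) (Q : quiver).
Local Notation A := (radsq0 k Q).
Local Notation vtxA e := (radsq0_vtx k e).
Local Notation arrA a := (radsq0_arr k a).
Local Notation coef := radsq0_coef.
Local Notation arrs s := (map (@radsq0_arr k Q) s).

(** The coordinate of x_1 (x)_E ... (x)_E x_n on the path al. *)
Fixpoint path_coef (al : seq (arr Q)) (s : seq A) : k :=
  if (al, s) is (a :: al', x :: s') then coef x (inr a) * path_coef al' s' else 1.

Definition path_cochain (al : seq (arr Q)) (m : A) (s : seq A) : A :=
  path_coef al s *: m.

Lemma path_coef_arrs al s : size s = size al -> path_coef al (arrs s) =
  (al == s)%:R.
Proof.
elim: al s => [|a al IH] [|b s] // [sn] /=.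
by rewrite IH // radsq0_coef_vec -natrM mulnb.
Qed.

Lemma mlin_path_cochain al m : mlin (size al) (path_cochain al m).
Proof.
rewrite /path_cochain; elim: al => [//|a al IH]; split=> [s sn c x y|x] /=.
  by rewrite radsq0_coefD radsq0_coefZ mulrDl scalerDl scalerA mulrA.
by apply: mlin_ext (mlinZ (coef x (inr a)) IH) => s _; rewrite -scalerA.
Qed.

Lemma normalized_path_cochain al m : normalized (size al) (path_cochain al m).
Proof.
move=> p e s; elim: p al => [|x p IH] [|a al] //; rewrite /path_cochain /=.
  by rewrite radsq0_coef_vec mul0r scale0r.
by move=> [/IH]; rewrite /path_cochain -scalerA => ->; rewrite scaler0.
Qed.

Lemma vtx_mulE e (x : A) :
  vtxA e * x = coef x (inl e) *: vtxA e +
    \sum_b coef x (inr b) *: (vtxA e * arrA b).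
Proof.
rewrite [in LHS](radsq0_decomp x) mulrDr !mulr_sumr; congr (_ + _); last first.
  by apply: eq_bigr => b _; rewrite radsq0_scaleAr.
rewrite (bigD1 e) //= -radsq0_scaleAr vtx_idem big1 ?addr0 // => f fe.
by rewrite -radsq0_scaleAr vtx_orth 1?eq_sym // scaler0.
Qed.

Lemma mul_vtxE e (x : A) :
  x * vtxA e = coef x (inl e) *: vtxA e +
    \sum_b coef x (inr b) *: (arrA b * vtxA e).
Proof.
rewrite [in LHS](radsq0_decomp x) mulrDl !mulr_suml; congr (_ + _); last first.
  by apply: eq_bigr => b _; rewrite radsq0_scaleAl.
rewrite (bigD1 e) //= -radsq0_scaleAl vtx_idem big1 ?addr0 // => f fe.
by rewrite -radsq0_scaleAl vtx_orth // scaler0.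
Qed.

Lemma mul_arr (y : arr Q) (x : A) : x * arrA y = coef x (inl (tgt y)) *: arrA y.
Proof.
have -> : arrA y = vtxA (tgt y) * arrA y by rewrite vtx_arr eqxx.
rewrite mulrA mul_vtxE mulrDl mulr_suml big1 ?addr0 ?radsq0_scaleAl // => b _.
by rewrite -radsq0_scaleAl -mulrA vtx_arr eqxx arr_arr scaler0.
Qed.

Local Notation R := (regular_bimodule k Q).

(** The coefficient of a product x y on an arrow a has two terms, with x or y
    contributing the vertex at one end of a. Along a path the term of x y at
    the source of a cancels the term of the next product at the end of the next
    arrow, so what remains is a term at the end of the path and the
    multiplication by the last argument, which prolongs the path at its
    source. *)
Lemma tail_dif_path_cochain e al (m : A) x s :
    is_path e al -> m * vtxA (last e (map (@src Q) al)) = m -> size s = size al ->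
  tail_dif (path_cochain al m : seq A -> R) (x :: s) =
  - path_cochain al (coef x (inl e) *: m) s
  + (-1) ^+ (size al).+1 *: \sum_b path_cochain (rcons al b) (m * arrA b) (x :: s)
    :> A.
Proof.
elim: al e x s => [|a al IH] e x [|y s] //= => [_ me _|/andP[/eqP<- pal] me [sn]].
  rewrite -[LHS]/(- ((1 *: m) * x)) /path_cochain /= !scale1r expr1 scaleN1r -opprD.
  rewrite -[in LHS]me -mulrA vtx_mulE mulrDr -radsq0_scaleAr me mulr_sumr.
  congr (- (_ + _)); apply: eq_bigr => b _.
  by rewrite mulr1 -radsq0_scaleAr mulrA me.
rewrite tail_dif2 {1}/path_cochain /= [coef (x * y) _]radsq0_coef_mul.
have -> : (fun r => path_cochain (a :: al) m (x :: r)) =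
  coef x (inr a) *: path_cochain al m.
  by apply: funext => r; rewrite /path_cochain /= -scalerA.
rewrite tail_difZ (IH _ _ _ pal me sn) scalerDr opprD addrA; congr (_ + _).
  rewrite /path_cochain /= !scalerN opprK !scalerA mulrDl scalerDl opprD.
  rewrite [X in _ + X *: m](_ : _ = coef x (inr a) * coef y (inl (src a)) *
    path_coef al s).
    by rewrite subrK; congr (- (_ *: _)); ring.
  by ring.
rewrite [in RHS]exprS -scalerA scaleN1r; congr (- _).
rewrite scalerA mulrC -scalerA scaler_sumr; congr (_ *: _); apply: eq_bigr => b _.
by rewrite /path_cochain /= scalerA.
Qed.

Lemma dif_path_cochain_arr al y s :
    is_path (tgt y) al -> last (tgt y) (map (@src Q) al) = src y ->
    size s = (size al).+1 ->
  dif (path_cochain al (arrA y) : seq A -> R) s = 0.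
Proof.
case: s => [//|x s] pal ly [sn]; rewrite /dif (tail_dif_path_cochain _ pal) //.
  rewrite big1 ?scaler0 ?addr0 => [|b _];
    last by rewrite arr_arr /path_cochain scaler0.
  by rewrite -[lact _ _]/(x * (_ *: _)) -radsq0_scaleAr mul_arr subrr.
by rewrite ly arr_vtx eqxx.
Qed.

(** The arrows b that prolong the closed path al at one of its ends appear with
    the shape of parD. *)
Lemma dif_path_cochain_vtx al e s :
    is_path e al -> last e (map (@src Q) al) = e -> size s = (size al).+1 ->
  dif (path_cochain al (vtxA e) : seq A -> R) s =
    \sum_(b | src b == e) path_cochain (b :: al) (arrA b) s
  + (-1) ^+ (size al).+1 *: \sum_(b | tgt b == e) path_cochain (rcons al b)
    (arrA b) s :> A.
Proof.
case: s => [//|x s] pal le [sn]; rewrite /dif (tail_dif_path_cochain _ pal) //;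
  last first.
  by rewrite le vtx_idem.
rewrite -[lact _ _]/(x * (_ *: _)) -radsq0_scaleAr mul_vtxE scalerDr addrA.
congr (_ + _ *: _).
  rewrite addrAC subrr add0r [RHS]big_mkcond scaler_sumr; apply: eq_bigr => b _.
  rewrite arr_vtx; case: eqP => _; rewrite ?scaler0 //.
  by rewrite /path_cochain /= scalerA mulrC.
rewrite [RHS]big_mkcond; apply: eq_bigr => b _.
by rewrite vtx_arr; case: eqP => // _; rewrite /path_cochain scaler0.
Qed.
End PathCochain.

(** * Parallel paths *)

Section Parallel.
Variables (k : fieldType) (Q : quiver).

Lemma is_path_rcons (e : vtx Q) s b :
  is_path e (rcons s b) = is_path e s && (tgt b == last e (map (@src Q) s)).
Proof. by elim: s e => [|a s IH] e /=; rewrite ?andbT // IH andbA. Qed.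

Lemma ptgt1 (p : qpath Q 1) : ptgt p = tgt (arrow_of p).
Proof.
case: p => -[e [[//|a [|//]] ?]] /=.
by move=> pe; have [/eqP ta _] := andP pe; rewrite -[LHS]/e -[RHS]/(tgt a).
Qed.
Lemma psrc1 (p : qpath Q 1) : psrc p = src (arrow_of p).
Proof.
case: p => -[e [[//|a [|//]] ?]] /=.
by [].
Qed.

Lemma par1P n (q : par Q n 1) :
  is_path (tgt (arrow_of (par2 q))) (arrows (par1 q)) /\
  last (tgt (arrow_of (par2 q))) (map (@src Q) (arrows (par1 q))) =
    src (arrow_of (par2 q)).
Proof.
have /andP[/eqP sp /eqP tp] := valP q.
by rewrite -ptgt1 -psrc1 /par2 -tp -sp; split=> //; exact: (valP (par1 q)).
Qed.

Lemma par0P n (q : par Q n 0) :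
  is_path (ptgt (par2 q)) (arrows (par1 q)) /\
  last (ptgt (par2 q)) (map (@src Q) (arrows (par1 q))) = ptgt (par2 q).
Proof.
have /andP[/eqP sp /eqP tp] := valP q.
rewrite /par2 -tp; split; first exact: (valP (par1 q)).
by rewrite -[LHS]/(psrc (par1 q)) sp tp /psrc [arrows _]tuple0.
Qed.

Lemma mk_par1 n (al : n.-tuple (arr Q)) y :
    is_path (tgt y) al -> last (tgt y) (map (@src Q) al) = src y ->
  exists q : par Q n 1, arrows (par1 q) = al /\ arrow_of (par2 q) = y.
Proof.
move=> pal ly; pose p : qpath Q n := exist _ (tgt y, al) pal.
have py : is_path (tgt y) [tuple y] by rewrite /= eqxx.
pose p' : qpath Q 1 := exist _ (tgt y, [tuple y]) py.
have pp : (psrc p == psrc p') && (ptgt p == ptgt p').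
  by rewrite eqxx andbT; apply/eqP; exact: ly.
by exists (exist _ (p, p') pp).
Qed.

Lemma mk_par0 n (al : n.-tuple (arr Q)) e :
    is_path e al -> last e (map (@src Q) al) = e ->
  exists q : par Q n 0, arrows (par1 q) = al /\ ptgt (par2 q) = e.
Proof.
move=> pal ly; pose p : qpath Q n := exist _ (e, al) pal.
pose p' : qpath Q 0 := exist (fun p : vtx Q * 0.-tuple (arr Q) => is_path p.1 p.2)
  (e, [tuple]) isT.
have pp : (psrc p == psrc p') && (ptgt p == ptgt p').
  by rewrite eqxx andbT; apply/eqP; exact: ly.
by exists (exist _ (p, p') pp).
Qed.

Lemma par1_inj n (q q' : par Q n 1) :
  arrows (par1 q) = arrows (par1 q') -> arrow_of (par2 q) = arrow_of (par2 q') ->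
    q = q'.
Proof.
move=> e1 e2.
have t2 : ptgt (par2 q) = ptgt (par2 q') by rewrite !ptgt1 e2.
have p2 : par2 q = par2 q'.
  apply: val_inj; rewrite [LHS]surjective_pairing [RHS]surjective_pairing.
  congr (_, _) => //; apply: val_inj => /=.
  move: e2; rewrite /arrow_of /arrows /thead.
  case: (val (par2 q)).2 => -[//|a [|//]] ?; case: (val (par2 q')).2 =>
    -[//|b [|//]] ?.
  by rewrite !(tnth_nth a) /= => ->.
have p1 : par1 q = par1 q'.
  apply: val_inj; rewrite [LHS]surjective_pairing [RHS]surjective_pairing.
  congr (_, _) => //; have /andP[_ /eqP] := valP q; have /andP[_ /eqP] := valP q'.
  by rewrite -[(val q).1]/(par1 q) -[(val q).2]/(par2 q) -[(val q').1]/(par1 q')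
    -[(val q').2]/(par2 q') t2 => <-.
by apply: val_inj; rewrite [LHS]surjective_pairing [RHS]surjective_pairing;
  congr (_, _).
Qed.

Lemma par0_inj n (q q' : par Q n 0) :
  arrows (par1 q) = arrows (par1 q') -> ptgt (par2 q) = ptgt (par2 q') -> q = q'.
Proof.
move=> e1 t2.
have p2 : par2 q = par2 q'.
  apply: val_inj; rewrite [LHS]surjective_pairing [RHS]surjective_pairing.
  by congr (_, _) => //; rewrite [LHS]tuple0 [RHS]tuple0.
have p1 : par1 q = par1 q'.
  apply: val_inj; rewrite [LHS]surjective_pairing [RHS]surjective_pairing.
  congr (_, _) => //; have /andP[_ /eqP] := valP q; have /andP[_ /eqP] := valP q'.
  by rewrite -[(val q).1]/(par1 q) -[(val q).2]/(par2 q) -[(val q').1]/(par1 q')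
    -[(val q').2]/(par2 q') t2 => <-.
by apply: val_inj; rewrite [LHS]surjective_pairing [RHS]surjective_pairing;
  congr (_, _).
Qed.
End Parallel.

(** * Cochains and parallel paths *)

Section Restriction.
Variables (k : fieldType) (Q : quiver).
Local Notation A := (radsq0 k Q).
Local Notation vtxA e := (radsq0_vtx k e).
Local Notation arrA a := (radsq0_arr k a).
Local Notation coef := radsq0_coef.
Local Notation arrs s := (map (@radsq0_arr k Q) s).
Local Notation R := (regular_bimodule k Q).

Definition par_seq n (v : kpar k Q n 1) : seq A -> R :=
  fun s => \sum_q (v : {ffun _ -> _}) q *:
    path_cochain (arrows (par1 q)) (arrA (arrow_of (par2 q))) s.

Lemma path_coef_tuple n (al : n.-tuple (arr Q)) (t : n.-tuple A) :
  \prod_(i < n) coef (tnth t i) (inr (tnth al i)) = path_coef al t.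
Proof.
elim: n al t => [|n IH] al t; first by rewrite big_ord0 [al]tuple0 [t]tuple0.
case/tupleP: al => a al; case/tupleP: t => x t.
rewrite big_ord_recl !tnth0 /= -IH; congr (_ * _).
by apply: eq_bigr => i _; rewrite !tnthS.
Qed.

Lemma par_cochainE n (v : kpar k Q n 1) (t : n.-tuple A) :
  par_cochain v t = par_seq v t.
Proof.
apply: eq_bigr => q _; rewrite /path_cochain scalerA; congr (_ * _ *: _).
exact: path_coef_tuple.
Qed.

Lemma par_seq_linear n c (u v : kpar k Q n 1) s :
  par_seq (c *: u + v) s = c *: par_seq u s + par_seq v s.
Proof.
rewrite /par_seq scaler_sumr -big_split /=; apply: eq_bigr => q _.
by move: (path_cochain _ _ _) => p; rewrite !ffunE scalerDl scalerA.
Qed.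

Definition par_seq_at n s (v : kpar k Q n 1) : A := par_seq v s.
HB.instance Definition _ n s := GRing.isLinear.Build k (kpar k Q n 1) A *:%R
  (@par_seq_at n s) (fun c u v => par_seq_linear c u v s).
Lemma par_seqD n (u v : kpar k Q n 1) s : par_seq (u + v) s = par_seq u s +
  par_seq v s.
Proof. exact: (linearD (par_seq_at s)). Qed.
Lemma par_seqZ n c (v : kpar k Q n 1) s : par_seq (c *: v) s = c *: par_seq v s.
Proof. exact: (linearZ_LR (par_seq_at s)). Qed.
Lemma par_seq_sum n I (r : seq I) (P : pred I) (v : I -> kpar k Q n 1) s :
  par_seq (\sum_(i <- r | P i) v i) s = \sum_(i <- r | P i) par_seq (v i) s.
Proof. exact: (linear_sum (par_seq_at s)). Qed.

Lemma mlin_par_seq n (v : kpar k Q n 1) : mlin n (par_seq v).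
Proof.
have mS : mlin n (\sum_q (v : {ffun _ -> _}) q *:
    (path_cochain (arrows (par1 q)) (arrA (arrow_of (par2 q))) : seq A -> R)).
  apply: mlin_sum => q; apply: mlinZ.
  by have := mlin_path_cochain (arrows (par1 q)) (arrA (arrow_of (par2 q)));
    rewrite size_tuple.
by apply: mlin_ext mS => s _; rewrite fct_sumE.
Qed.

Lemma dif_par_seq n (v : kpar k Q n 1) : is_cocycle n (par_seq v).
Proof.
move=> s sn.
have -> : par_seq v = \sum_q (v : {ffun _ -> _}) q *:
    (path_cochain (arrows (par1 q)) (arrA (arrow_of (par2 q))) : seq A -> R).
  by apply: funext => r; rewrite fct_sumE.
rewrite -[LHS]/(dif_at s _) linear_sum big1 // => q _.
rewrite linearZ /= -[dif_at _ _]/(dif _ s); have [pq lq] := par1P q.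
by rewrite dif_path_cochain_arr ?scaler0 // size_tuple.
Qed.

Lemma par_seq_kpar_vec n (al : n.-tuple (arr Q)) y s :
    is_path (tgt y) al -> last (tgt y) (map (@src Q) al) = src y ->
  par_seq (kpar_vec k al y) s = path_cochain al (arrA y) s.
Proof.
move=> pal ly; have [q [qa qy]] := mk_par1 pal ly.
rewrite /par_seq (bigD1 q) //= big1 ?addr0 => [|q' qq'].
  by rewrite ffunE qa qy !eqxx scale1r.
rewrite ffunE; case: andP => [[/eqP ea /eqP ey]|_]; last by rewrite scale0r.
by case/eqP: qq'; apply: par1_inj; rewrite ?ea ?ey.
Qed.

(** The cochains with values in E whose coboundaries are the cochains of the
    image of parD. *)
Definition closed_path_seq n (w : kpar k Q n 0) : seq A -> R :=
  \sum_q (w : {ffun _ -> _}) q *: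
    (path_cochain (arrows (par1 q)) (vtxA (ptgt (par2 q))) : seq A -> R).

Lemma mlin_closed_path_seq n (w : kpar k Q n 0) : mlin n (closed_path_seq w).
Proof.
apply: mlin_sum => q; apply: mlinZ.
have := mlin_path_cochain (arrows (par1 q)) (vtxA (ptgt (par2 q))).
by rewrite size_tuple.
Qed.

Lemma par_seq_parD n (w : kpar k Q n 0) s : size s = n.+1 ->
  par_seq (parD w) s = dif (closed_path_seq w) s.
Proof.
move=> sn; rewrite -[RHS]/(dif_at s _) linear_sum.
rewrite par_seq_sum; apply: eq_bigr => q _; rewrite linearZ par_seqZ;
  congr (_ *: _).
rewrite -[RHS]/(dif _ s); have [pq lq] := par0P q.
rewrite dif_path_cochain_vtx ?size_tuple // par_seqD par_seqZ !par_seq_sum.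
congr (_ + _ *: _); apply: eq_bigr => b /eqP be; rewrite par_seq_kpar_vec //=.
- by rewrite eqxx be.
- by rewrite be lq.
- by rewrite be is_path_rcons pq be lq eqxx.
- by rewrite map_rcons last_rcons.
Qed.

Definition res_arr n (F : seq A -> A) : kpar k Q n 1 :=
  [ffun q => coef (F (arrs (arrows (par1 q)))) (inr (arrow_of (par2 q)))].
Definition res_vtx n (F : seq A -> A) : kpar k Q n 0 :=
  [ffun q => coef (F (arrs (arrows (par1 q)))) (inl (ptgt (par2 q)))].

Lemma res_arr_linear n c F G : res_arr n (c *: F + G) = c *: res_arr n F +
  res_arr n G.
Proof. by apply/ffunP => q; rewrite !ffunE radsq0_coefD radsq0_coefZ. Qed.

Lemma par_seq_arrs n (v : kpar k Q n 1) (s : seq (arr Q)) : size s = n ->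
  par_seq v (arrs s) = \sum_(q : par Q n 1 | tval (arrows (par1 q)) == s)
     (v : {ffun _ -> _}) q *: arrA (arrow_of (par2 q)).
Proof.
move=> sn; rewrite [RHS]big_mkcond; apply: eq_bigr => q _.
rewrite /path_cochain path_coef_arrs ?size_tuple //.
by case: eqP => _; rewrite ?scale1r // scale0r scaler0.
Qed.

Lemma coef_par_seq n (v : kpar k Q n 1) (q : par Q n 1) :
  coef (par_seq v (arrs (arrows (par1 q)))) (inr (arrow_of (par2 q))) =
    (v : {ffun _ -> _}) q.
Proof.
rewrite par_seq_arrs ?size_tuple // radsq0_coef_sum (bigD1 q) //=.
rewrite radsq0_coefZ radsq0_coef_vec eqxx mulr1 big1 ?addr0 // =>
  q' /andP[/eqP ea qq'].
rewrite radsq0_coefZ radsq0_coef_vec; case: eqP => [[ey]|_]; last by rewrite mulr0.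
by case/eqP: qq'; apply: par1_inj => //; apply: val_inj.
Qed.

Lemma res_arr_par_seq n (v : kpar k Q n 1) : res_arr n (par_seq v) = v.
Proof. by apply/ffunP => q; rewrite ffunE coef_par_seq. Qed.

(** All products of consecutive arrows vanish. *)
Lemma tail_dif_arrs n (F : seq A -> R) a s : mlin n F -> size s = n ->
  tail_dif F (arrs (a :: s)) =
  (-1) ^+ n.+1 *: (F (arrs (belast a s)) * arrA (last a s)) :> A.
Proof.
elim: n F a s => [|n IH] F a [|b s] // mF; first by rewrite expr1 scaleN1r.
move=> [sn]; have [linF mFx] := mF.
rewrite -[arrs _]/[:: arrA a, arrA b & arrs s] tail_dif2 arr_arr.
rewrite (linear_fun0 (linF _ _)) ?size_map // oppr0 add0r.
by rewrite -[arrA b :: arrs s]/(arrs (b :: s)) (IH _ _ _ (mFx _) sn) [in RHS]exprS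
  mulN1r scaleNr.
Qed.

Lemma arr_mul (y : arr Q) (x : A) : arrA y * x = coef x (inl (src y)) *: arrA y.
Proof.
have -> : arrA y = arrA y * vtxA (src y) by rewrite arr_vtx eqxx.
rewrite -mulrA vtx_mulE mulrDr mulr_sumr big1 ?addr0 => [|b _]; last first.
  by rewrite -radsq0_scaleAr mulrA arr_vtx eqxx arr_arr scaler0.
by rewrite -radsq0_scaleAr arr_vtx eqxx.
Qed.

(** The coefficient of w at a closed path c contributes to a path parallel to
    the arrow y exactly when this path is y c or c y; for a single path, both
    can happen. *)
Lemma parDE n (w : kpar k Q n 0) (q' : par Q n.+1 1) :
  let y := arrow_of (par2 q') in
  (parD w : {ffun _ -> _}) q' =
    \sum_q (w : {ffun _ -> _}) q *
      ((tval (arrows (par1 q')) == y :: arrows (par1 q)) &&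
        (src y == ptgt (par2 q)))%:R
  + (-1) ^+ n.+1 * \sum_q (w : {ffun _ -> _}) q *
      ((tval (arrows (par1 q')) == rcons (arrows (par1 q)) y) &&
        (tgt y == ptgt (par2 q)))%:R.
Proof.
move=> y; rewrite mulr_sumr -big_split /= sum_ffunE; apply: eq_bigr => q _.
rewrite !ffunE !sum_ffunE mulrCA -mulrDr; congr (_ * (_ + _ * _)).
  rewrite big_mkcond (bigD1 y) //= big1 ?addr0 => [|b by_]; last first.
    by case: ifP => // _; rewrite ffunE -/y [y == b]eq_sym (negPf by_) andbF.
  by rewrite ffunE -/y eqxx andbT andbC; case: (src y == _).
rewrite big_mkcond (bigD1 y) //= big1 ?addr0 => [|b by_]; last first.
  by case: ifP => // _; rewrite ffunE -/y [y == b]eq_sym (negPf by_) andbF.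
by rewrite ffunE -/y eqxx andbT andbC; case: (tgt y == _).
Qed.

(** Selects the closed path q0 in the sums of [parDE]. *)
Lemma sum_par0_delta n (w : kpar k Q n 0) (q0 : par Q n 0) (P : pred (par Q n 0)) :
    (forall q, P q = (tval (arrows (par1 q0)) == arrows (par1 q)) &&
      (ptgt (par2 q0) == ptgt (par2 q))) ->
  \sum_q (w : {ffun _ -> _}) q * (P q)%:R = (w : {ffun _ -> _}) q0.
Proof.
move=> PE; rewrite (bigD1 q0) //= PE !eqxx mulr1 big1 ?addr0 // => q qq0.
rewrite PE; case: andP => [[/eqP ea /eqP ee]|_]; last by rewrite mulr0.
by case/eqP: qq0; apply/esym/par0_inj => //; apply: val_inj.
Qed.

Lemma res_arr_dif n (F : seq A -> R) : mlin n F ->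
  res_arr n.+1 (dif F) = parD (res_vtx n F).
Proof.
move=> mF; apply/ffunP => q'; rewrite parDE ffunE; have [pq lq] := par1P q'.
set y := arrow_of _ in pq lq *; move: pq lq; case/tupleP: (arrows _) => a al /=.
move=> /andP[/eqP ta pal] la.
rewrite -[_ :: arrs al]/(arrs (a :: al)) /dif.
rewrite -/(arrs (a :: al)) (tail_dif_arrs _ mF) ?size_tuple //.
rewrite arr_mul mul_arr scalerA radsq0_coefD !radsq0_coefZ !radsq0_coef_vec.
congr (_ + _).
  case: (eqVneq y a) => [ya|ya]; last first.
    rewrite (_ : (inr y == inr a) = false) ?mulr0; last exact: negPf ya.
    by rewrite big1 // => q _; rewrite eqseq_cons [a == y]eq_sym (negPf ya) mulr0.
  rewrite -ya eqxx mulr1.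
  have [q0 [q0a q0e]] : exists q : par Q n 0, arrows (par1 q) =
    al /\ ptgt (par2 q) = src y.
    by apply: mk_par0; [rewrite ya | rewrite {1}ya].
  rewrite (@sum_par0_delta _ _ q0) ?ffunE ?q0a ?q0e // => q.
  by rewrite eqseq_cons eqxx.
rewrite -mulrA; congr (_ * _).
have Eal : a :: al = rcons (belast a al) (last a al) by rewrite lastI.
case: (eqVneq y (last a al)) => [ya|ya]; last first.
  rewrite (_ : (inr y == inr _) = false) ?mulr0; last exact: negPf ya.
  by rewrite big1 // => q _; rewrite Eal eqseq_rcons [last a al == y]eq_sym
    (negPf ya) andbF mulr0.
rewrite -ya eqxx mulr1.
have sb : size (belast a al) == n by rewrite size_belast size_tuple.
have [q0 [q0a q0e]] : exists q : par Q n 0, arrows (par1 q) =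
  Tuple sb /\ ptgt (par2 q) = tgt y.
  have : is_path (tgt y) (a :: al) by rewrite /= ta eqxx.
  rewrite Eal is_path_rcons -ya => /andP[pb /eqP lb].
  exact: mk_par0.
rewrite (@sum_par0_delta _ _ q0) ?ffunE ?q0a ?q0e // => q.
by rewrite Eal -ya eqseq_rcons eqxx andbT.
Qed.
End Restriction.

(** * Injectivity of parD *)

Lemma inj_surj_bij (T T' : finType) (f : T -> T') :
  injective f -> (forall y, exists x, f x = y) -> bijective f.
Proof.
move=> fI fS; apply: inj_card_bij => //; rewrite -(card_codom fI).
by apply/subset_leq_card/subsetP => y _; have [x <-] := fS y; exact: codom_f.
Qed.

Section Cycle.
Variable Q : quiver.
Variables (good : pred (vtx Q)) (e : vtx Q).
Hypothesis out_good : forall v, good v ->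
  exists a : arr Q, [/\ src a = v, good (tgt a) & forall b, src b = v -> b = a].
Hypothesis in_good : forall v, good v ->
  forall a b : arr Q, tgt a = v -> tgt b = v -> a = b.
Hypothesis ge : good e.

Let out (v : vtx Q) : option (arr Q) := [pick a | src a == v].
Let next (v : vtx Q) : vtx Q := if out v is Some a then tgt a else v.

Let outP v : good v -> exists2 a, out v = Some a &
  [/\ src a = v, next v = tgt a, good (next v) & forall b, src b = v -> b = a].
Proof.
move=> gv; have [a [sa ga ua]] := out_good gv.
have ova : out v = Some a.
  by rewrite /out; case: pickP => [b /eqP/ua->|/(_ a)] //; rewrite sa eqxx.
by exists a => //; rewrite /next ova.
Qed.

Let next_good v : good v -> good (next v).
Proof. by move=> /outP[a _ []]. Qed.

Let next_inj : {in good &, injective next}.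
Proof.
move=> u v gu gv; have [a _ [sa na gna _]] := outP gu; have [b _ [sb nb _ _]] :=
  outP gv.
move=> E; rewrite -sa -sb; congr src; apply: (in_good gna) => //.
by rewrite -nb -E.
Qed.

Let iter_good i : good (iter i next e).
Proof. by elim: i => //= i; apply: next_good. Qed.

Let iter_period : iter (order next e) next e = e.
Proof. exact: (iter_order_in next_good next_inj ge). Qed.

Let comp_orbit w : connect (@adjacent Q) e w -> fconnect next e w.
Proof.
move=> /connectP[p pp ->]; elim/last_ind: p pp => [|p u IH] //.
rewrite rcons_path last_rcons => /andP[/IH {IH}]; set v := last e p.
move=> /iter_findex; set i := findex _ _ _ =>
  vE /existsP[a /orP[]] /andP[/eqP sa /eqP ta].
  have [b _ [sb nb _ ub]] := outP (iter_good i).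
  by rewrite -ta (ub a) ?vE // -nb -iterS fconnect_iter.
have [j jE] : exists j, iter j.+1 next e = v.
  exists (i + (order next e).-1)%N; rewrite -addnS prednK ?order_gt0 //.
  by rewrite iterD iter_period.
have [b _ [sb nb gb _]] := outP (iter_good j).
rewrite -sa (_ : a = b) ?sb ?fconnect_iter //.
by apply: (in_good (iter_good j.+1)); rewrite -?nb // ta jE.
Qed.

Let connect_next i : connect (@adjacent Q) e (iter i next e).
Proof.
elim: i => [|i IH] /=; first exact: connect0.
apply: connect_trans IH _; apply: connect1; have [a _ [sa na _ _]] :=
  outP (iter_good i).
by apply/existsP; exists a; rewrite sa na !eqxx.
Qed.

(** Following the only arrow that leaves a good vertex gives a map next that
    preserves good vertices and is injective on them, so e is periodic. Its
    orbit is closed under adjacency, because arrows into or out of good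
    vertices are the ones between consecutive points of the orbit: hence it is
    the whole component of e. *)
Lemma oriented_cycle_of_unique_arrows : oriented_cycle (component e).
Proof.
have o0 := order_gt0 next e; pose l := (order next e).-1.
have lE : l.+1 = order next e by rewrite prednK.
pose v (i : 'I_l.+1) : vtx (component e) :=
  exist _ (iter i next e) (connect_next i).
have outI (i : 'I_l.+1) : {a : arr Q | src a == iter i next e}.
  apply: sigW; have [a _ [sa _ _ _]] := outP (iter_good i).
  by exists a; rewrite sa.
have conI (i : 'I_l.+1) : connect (@adjacent Q) e (src (val (outI i))).
  by rewrite (eqP (valP (outI i))).
pose a (i : 'I_l.+1) : arr (component e) := exist _ (val (outI i)) (conI i).
have srca i : src (a i) = v i by apply: val_inj; exact: (eqP (valP (outI i))).
have vI : injective v.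
  move=> i j /(congr1 val) /= E; apply/val_inj/eqP => /=.
  have lt_o (r : 'I_l.+1) : (r < order next e)%N by rewrite -lE.
  rewrite -(nth_uniq e _ _ (orbit_uniq next e)) ?size_orbit //.
  by rewrite !nth_traject // E.
have vS w : exists i, v i = w.
  have wc := comp_orbit (valP w); have lt_o := findex_max wc; rewrite -lE in lt_o.
  by exists (Ordinal lt_o); apply: val_inj; rewrite /= iter_findex.
exists l, v, a; split.
- exact: inj_surj_bij.
- apply: inj_surj_bij => [i j ij|b]; first by apply: vI; rewrite -!srca ij.
  have [i iE] := vS (src b); exists i; apply: val_inj.
  have [c _ [_ _ _ uc]] := outP (iter_good i).
  rewrite (uc (val b)); first by apply: uc; exact: (eqP (valP (outI i))).
  by rewrite -[RHS]/(val (v i)) iE.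
- move=> i; split=> //; apply: val_inj => /=.
  have [c _ [sc nc _ uc]] := outP (iter_good i).
  rewrite (uc (val (outI i))) ?(eqP (valP (outI i))) // -nc.
  have := ltn_ord i; rewrite ltnS leq_eqVlt => /orP[/eqP il|il].
    by rewrite -iterS il lE iter_period modnn.
  by rewrite modn_small ?ltnS.
Qed.
End Cycle.

Section Injectivity.
Variables (k : fieldType) (Q : quiver) (n : nat).
Hypothesis hQ : forall v : vtx Q, ~ oriented_cycle (component v).

(** Let the closed path c based at e have a nonzero coefficient in w. For an
    arrow b out of e, the path b c is parallel to b, and the coefficient of c
    in parD w at (b c, b) can only be cancelled by that of a closed path c',
    possibly c itself, with b c = c' b: then b is the last arrow of c, and c' is a rotation of c, based
    at the end of b, whose coefficient is nonzero too. For an arrow b into e,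
    the same argument with c b shows that b is the first arrow of c. So the
    base points of closed paths with nonzero coefficient have a unique outgoing
    and a unique incoming arrow, and their component would be an oriented
    cycle. *)
Lemma parD_inj (w : kpar k Q n.+1 0) : parD w = 0 -> w = 0.
Proof.
move=> Dw; apply/ffunP => q0; rewrite [RHS]ffunE; apply: contrapT => wq0.
pose good v := `[< exists2 q : par Q n.+1 0, ptgt (par2 q) =
  v & (w : {ffun _ -> _}) q <> 0 >].
have D0 q' : (parD w : {ffun _ -> _}) q' = 0 by rewrite Dw ffunE.
have ends_of (q : par Q n.+1 0) : (w : {ffun _ -> _}) q <> 0 ->
    exists a s, [/\ tval (arrows (par1 q)) = a :: s, src (last a s) =
      ptgt (par2 q) & tgt a = ptgt (par2 q)].
  have [pq lq] := par0P q; move: pq lq; case/tupleP: (arrows _) => a s /=.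
  by move=> /andP[/eqP ta _] la _; exists a, s; split=> //; rewrite -la last_map.
have outG q : (w : {ffun _ -> _}) q <> 0 -> forall c, src c = ptgt (par2 q) ->
    c = last c (arrows (par1 q)) /\ good (tgt c).
  move=> wq c sc; have [pq lq] := par0P q.
  have [||q' [qa qc]] := @mk_par1 _ _ [tuple of c :: arrows (par1 q)] c.
  - by rewrite /= eqxx sc.
  - by rewrite /= sc.
  have := D0 q'; rewrite parDE qc qa.
  rewrite (@sum_par0_delta _ _ _ _ q) => [|r]; last first.
    by rewrite /= eqseq_cons eqxx sc.
  move=> D; have : exists2 r, (w : {ffun _ -> _}) r <> 0 &
      ((c :: arrows (par1 q) == rcons (arrows (par1 r)) c) &&
        (tgt c == ptgt (par2 r))).
    apply: contrapT => nr; apply: wq; rewrite -D big1 ?mulr0 ?addr0 // => r _.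
    case E: (_ && _); rewrite ?mulr0 // mulr1; apply: contrapT => wr.
    by apply: nr; exists r.
  case=> r wr /andP[/eqP rc /eqP tc]; split.
    by have := congr1 (last c) rc; rewrite last_rcons.
  by apply/asboolP; exists r.
have inG q : (w : {ffun _ -> _}) q <> 0 -> forall c, tgt c = ptgt (par2 q) ->
    c = head c (arrows (par1 q)).
  move=> wq c tc; have [pq lq] := par0P q.
  have [||q' [qa qc]] := @mk_par1 _ _ [tuple of rcons (arrows (par1 q)) c] c.
  - by rewrite /= is_path_rcons tc pq lq eqxx.
  - by rewrite /= map_rcons last_rcons.
  have := D0 q'; rewrite parDE qc qa [X in _ + _ * X](@sum_par0_delta _ _ _ _ q)
    => [|r]; last first.
    by rewrite /= eqseq_rcons eqxx andbT tc.
  move=> D; apply: contrapT => ch; apply: wq.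
  have : (-1) ^+ n.+2 * (w : {ffun _ -> _}) q = 0.
    rewrite -[RHS]D big1 ?add0r // => r _.
    case/tupleP: (arrows (par1 q)) ch => a s /= /eqP ch.
    by rewrite eqseq_cons [a == c]eq_sym (negPf ch) mulr0.
  by move/eqP; rewrite mulf_eq0 signr_eq0 => /eqP.
apply: (hQ (v := ptgt (par2 q0))); apply: (@oriented_cycle_of_unique_arrows Q good).
- move=> v /asboolP[q qv wq]; have [a [s [qa sa ta]]] := ends_of q wq.
  exists (last a s); split; first by rewrite sa.
    by have [] := outG q wq _ sa.
  by move=> b sb; have [] := outG q wq b; rewrite ?sb // qa /=.
- move=> v /asboolP[q qv wq] a b ta tb.
  by rewrite (inG q wq a) ?ta // (inG q wq b) ?tb //; case/tupleP: (arrows _).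
- by apply/asboolP; exists q0.
Qed.
End Injectivity.

(** * The Lie derivative of a cochain *)

Section Lie.
Variables (k : fieldType) (Q : quiver).
Local Notation A := (radsq0 k Q).
Local Notation R := (regular_bimodule k Q).

(** The Gerstenhaber bracket of the 1-cochain f with F, in a recursive form
    suited to the one of the differential; see [gbracketE]. *)
Fixpoint lie (f : A -> A) (F : seq A -> R) (s : seq A) : R :=
  if s is x :: s' then lie f (fun r => F (x :: r)) s' - F (f x :: s')
  else f (F [::]).

Lemma lieE f F s :
  lie f F s = f (F s) -
    \sum_(i < size s) F (take i s ++ f s`_i :: drop i.+1 s).
Proof.
elim: s F => [|x s IH] F; first by rewrite big_ord0 subr0.
by rewrite /= IH big_ord_recl /= drop0 opprD addrA [RHS]addrAC.
Qed.

Lemma lie_ext f F G s : (forall r, size r = size s -> F r = G r) ->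
  lie f F s = lie f G s.
Proof.
elim: s F G => [|x s IH] F G FG /=; first by rewrite FG.
by rewrite FG // (IH _ (fun r => G (x :: r))) // => r rs; apply: FG; rewrite /= rs.
Qed.

Lemma lieP f c F G s : linear f -> lie f (c *: F + G) s = c *: lie f F s +
  lie f G s.
Proof.
move=> lf; elim: s F G => [|x s IH] F G; first exact: lf.
rewrite /= -[fun r => _]/(c *: (fun r => F (x :: r)) + (fun r => G (x :: r))) IH.
by rewrite -[(c *: F + G) _]/(c *: F _ + G _) opprD addrACA scalerBr.
Qed.

Lemma lie_addf f g n F s : mlin n F -> size s = n ->
  lie (fun x => f x + g x) F s = lie f F s + lie g F s.
Proof.
elim: n F s => [|n IH] F [|x s] // [linF mF] [sn] /=.
rewrite (IH _ _ (mF x) sn); have := linF s sn 1 (f x) (g x); rewrite !scale1r => ->.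
by rewrite opprD addrACA.
Qed.

Lemma mlin_lie f n F : linear f -> mlin n F -> mlin n (lie f F).
Proof.
move=> lf; elim: n F => [//|n IH] F [linF mF]; split=> [s sn c x y|x].
  rewrite /= lf linF // opprD scalerBr [RHS]addrACA; congr (_ + _).
  rewrite -lieP //; apply: lie_ext => r rs.
  by rewrite linF // rs.
exact: mlinB (IH _ (mF x)) (mF (f x)).
Qed.

Lemma lieN f F s : linear f -> lie f (- F) s = - lie f F s.
Proof.
move=> lf; have l0 : lie f 0 s = 0.
  by have := lieP (-1) 0 0 s lf; rewrite scaler0 addr0 scaleN1r addNr.
have -> : - F = -1 *: F + 0 by rewrite scaleN1r addr0.
by rewrite lieP // l0 addr0 scaleN1r.
Qed.

Section Derivation.
Variable f : A -> A.
Hypothesis lf : linear f.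
Hypothesis df : forall x y, f (x * y) = f x * y + x * f y.

Let fN x : f (- x) = - f x.
Proof.
by have := lf (-1) x 0; rewrite addr0 scaleN1r (linear_fun0 lf) addr0 scaleN1r.
Qed.

Lemma lie_mull x F s : lie f (fun r => x * F r) s = f x * F s + x * lie f F s.
Proof.
elim: s F => [|y s IH] F; first exact: df.
by rewrite /= IH mulrBr addrA.
Qed.

(** Both sides expand along the first two arguments. The terms where f hits the
    product x y agree by the Leibniz rule and the additivity of F in its first
    argument; the other ones agree by induction. *)
Lemma tail_dif_lie n F s : mlin n F -> size s = n.+1 ->
  tail_dif (lie f F) s = lie f (tail_dif F) s.
Proof.
elim: n F s => [|n IH] F [|x [|y s]] // mF => [_|[sn]].
  rewrite -[LHS]/(- (f (F [::]) * x))
    -[RHS]/(f (- (F [::] * x)) - - (F [::] * f x)).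
  by rewrite fN df opprK opprD addrNK.
have [linF mFx] := mF.
have addF z z' : F (z + z' :: s) = F (z :: s) + F (z' :: s).
  by have := linF s sn 1 z z'; rewrite !scale1r.
pose G r := if r is z :: r' then F (x * z :: r') else 0.
rewrite tail_dif2 -[X in _ = X]/(lie f (fun r => tail_dif F (x :: r)) (y :: s) -
  tail_dif F [:: f x, y & s]).
rewrite [lie f (fun r => tail_dif F (x :: r)) _](@lie_ext f _
  (- G - tail_dif (fun r => F (x :: r)))) => [|[|z r]] //.
rewrite -[- G]scaleN1r lieP // lieN // scaleN1r  -(IH _ (y :: s) (mFx x)) /= ?sn //.
rewrite [tail_dif F _]tail_dif2.
have -> : tail_dif (fun r => lie f (fun t => F (x :: t)) r - F (f x :: r))
  (y :: s) =
   tail_dif (lie f (fun t => F (x :: t))) (y :: s) - tail_dif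
     (fun r => F (f x :: r)) (y :: s).
  by rewrite -tail_difN -tail_difD.
rewrite df addF.
set a := lie _ _ _; set b := tail_dif _ _; set c := tail_dif _ _.

rewrite !opprD !opprK [RHS]addrACA; congr (_ + _).
by rewrite addrA addrAC.
Qed.

Lemma dif_lie n F s : mlin n F -> size s = n.+1 ->
  dif (lie f F) s = lie f (dif F) s.
Proof.
case: s => [//|x s] mF sn; rewrite {1}/dif (tail_dif_lie mF sn).
rewrite -[RHS]/(lie f (fun r => dif F (x :: r)) s - dif F (f x :: s)).
have -> : lie f (fun r => dif F (x :: r)) s =
    lie f (1 *: (fun r => x * F r) + (fun r => tail_dif F (x :: r))) s.
  by apply: lie_ext => r _; rewrite scale1r.
rewrite lieP // scale1r lie_mull -[dif F _]/(f x * F s + tail_dif F (f x :: s)).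
rewrite -[lact _ _]/(x * lie f F s)
  -[lie f (tail_dif F) _]/(lie f (fun r => tail_dif F (x :: r)) s - tail_dif F
  (f x :: s)).
by rewrite opprD addrACA [_ + x * _]addrC addrK.
Qed.

End Derivation.
End Lie.

(** * Cochains on tuples *)

Section Tuples.
Variables (k : fieldType) (Q : quiver).
Local Notation A := (radsq0 k Q).
Local Notation R := (regular_bimodule k Q).

Definition seqfun n (f : n.-tuple A -> A) : seq A -> R := fun s =>
  f (seq_tuple n s).

Lemma seq_tupleK n (t : n.-tuple A) : seq_tuple n t = t.
Proof. by apply: eq_from_tnth => i; rewrite tnth_mktuple (tnth_nth 0). Qed.

Lemma seqfunE n (f : n.-tuple A -> A) (t : n.-tuple A) : seqfun f t = f t.
Proof. by rewrite /seqfun seq_tupleK. Qed.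

Lemma seqfun_tval n (F : seq A -> R) s : size s = n ->
  seqfun (fun t : n.-tuple A => F t) s = F s.
Proof.
by move=> /eqP sn; rewrite -[s]/(tval (Tuple sn)) seqfunE.
Qed.

Lemma replace_tupleE n (t : n.-tuple A) (i : 'I_n) z :
  [tuple if j == i then z else tnth t j | j < n] = take i t ++
    z :: drop i.+1 t :> seq A.
Proof.
have lti : (i < size t)%N by rewrite size_tuple.
have sz : size (take i t ++ z :: drop i.+1 t) = n.
  by rewrite size_cat /= size_take lti size_drop size_tuple subnSK // subnKC //
    ltnW.
apply: (@eq_from_nth _ 0) => [|j]; rewrite size_tuple ?sz // => jn.
rewrite -[j]/(val (Ordinal jn)) -tnth_nth tnth_mktuple nth_cat size_take lti /=.
rewrite -val_eqE /=; case: ltngtP => [ji|ji|->]; last by rewrite subnn.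
  by rewrite nth_take // (tnth_nth 0).
by rewrite (tnth_nth 0) /= -{2}(subnKC ji) addSnnS addKn /= nth_drop subnKC.
Qed.

Lemma mlin_of_at n (F : seq A -> R) :
  (forall p c x y s, (size p + (size s).+1)%N = n ->
     F (p ++ (c *: x + y) :: s) = c *: F (p ++ x :: s) + F (p ++ y :: s)) ->
  mlin n F.
Proof.
elim: n F => [//|n IH] F lF; split=> [s sn c x y|x].
  by apply: (lF [::]); rewrite /= sn.
by apply: IH => p c y z s sn; apply: (lF (x :: p)); rewrite /= addSn sn.
Qed.

Lemma multilinear_mlin n (f : n.-tuple A -> A) : multilinear f <->
  mlin n (seqfun f).
Proof.
split=> [mf|mF].
  apply: mlin_of_at => p c x y s sn.
  have lt_pn : (size p < n)%N by rewrite -sn addnS ltnS leq_addr.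
  pose t := seq_tuple n (p ++ 0 :: s).
  have E z : seq_tuple n (p ++ z :: s) =
      [tuple if j == Ordinal lt_pn then z else tnth t j | j < n].
    apply: eq_from_tnth => j; rewrite !tnth_mktuple -val_eqE /= !nth_cat.
    case: ltngtP => // [pj|->]; last by rewrite subnn.
    by rewrite -(subnKC pj) addSnnS addKn.
  by rewrite /seqfun !E; apply: mf.
move=> i t c x y /=; rewrite -![f _]seqfunE !replace_tupleE;
  apply: (mlin_at _ _ _ mF).
rewrite size_take size_drop size_tuple ltn_ord subnSK // subnKC //.
exact: ltnW.
Qed.

Lemma tail_difE n (F : seq A -> R) s : size s = n.+1 ->
  tail_dif F s =
    \sum_(i < n) (-1) ^+ i.+1 * F (take i s ++ (s`_i * s`_i.+1) :: drop i.+2 s)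
  + (-1) ^+ n.+1 * (F (take n s) * s`_n) :> A.
Proof.
elim: n F s => [|n IH] F [|x [|y s]] //.
  by move=> _; rewrite big_ord0 add0r expr1 mulN1r.
move=> [sn]; rewrite tail_dif2 (IH _ (y :: s)) /= ?sn // big_ord_recl /=
  drop0 expr1 mulN1r.
rewrite opprD addrA -sumrN; congr (_ + _ + _);
  last by rewrite [in RHS]exprS mulN1r mulNr.
by apply: eq_bigr => i _; rewrite [in RHS]exprS mulN1r mulNr.
Qed.

Lemma hoch_dE n (f : n.-tuple A -> A) (t : n.+1.-tuple A) :
  hoch_d f t = dif (seqfun f) t.
Proof.
case/tupleP: t => x t; rewrite /hoch_d -addrA.
rewrite -[RHS]/(x * seqfun f t + tail_dif (seqfun f) (x :: t)) (@tail_difE n) /=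
  ?size_tuple //.
by rewrite drop0.
Qed.

Lemma dif_seqfun n (f : n.-tuple A -> A) s : size s = n.+1 ->
  dif (seqfun f) s = seqfun (hoch_d f) s.
Proof.
by move=> /eqP sn; rewrite -[s]/(tval (Tuple sn)) seqfunE hoch_dE.
Qed.

Lemma cocycle_predE n (f : n.-tuple A -> A) :
  (f \in @cocycle_pred k Q n) <-> mlin n (seqfun f) /\ is_cocycle n (seqfun f).
Proof.
split=> [/asboolP[mf df]|[mf df]].
  by split=> [|s sn]; [exact/multilinear_mlin | rewrite dif_seqfun // /seqfun df].
apply/asboolP; split=> [|t]; first exact/multilinear_mlin.
by rewrite hoch_dE df // size_tuple.
Qed.

Lemma coboundaryE n (f : n.+1.-tuple A -> A) :
  coboundary f <-> exists2 H : seq A -> R, mlin n H &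
    forall s, size s = n.+1 -> seqfun f s = dif H s.
Proof.
split=> [[g mg fg]|[H mH fH]].
  exists (seqfun g); first exact/multilinear_mlin.
  by move=> s sn; rewrite dif_seqfun // /seqfun fg.
have E r : size r = n -> seqfun (fun t : n.-tuple A => H t) r =
  H r by exact: seqfun_tval.
exists (fun t : n.-tuple A => H t).
  by apply/multilinear_mlin; apply: mlin_ext mH => s /E.
move=> t; rewrite hoch_dE -[f t]seqfunE fH ?size_tuple //;
  apply: (@dif_ext k Q R) => r.
by rewrite size_tuple => -[/E ->].
Qed.

Lemma gbracketE n (f : 1.-tuple A -> A) (g : n.-tuple A -> A) s : size s = n ->
  gbracket f g (seq_tuple _ s) = lie (fun x => f [tuple x]) (seqfun g) s.
Proof.
move=> sn; rewrite /gbracket mul0n expr0 mul1r lieE.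
have sE : tval (seq_tuple (1 + n).-1 s) = s.
  by move/eqP: sn => sn; rewrite -[s]/(tval (Tuple sn));
    exact: (congr1 val (seq_tupleK _)).
have one x : seq_tuple 1 [:: x] = [tuple x] := seq_tupleK [tuple x].
rewrite sE /gcirc /gcirc_at; congr (_ - _).
  rewrite big_ord_recl big_ord0 addr0 mul0n expr0 mul1r take0 drop0 /=
    take_oversize ?sn //.
  by rewrite -one /=; congr f; apply: eq_from_tnth => i; rewrite !tnth_mktuple ord1.
rewrite sn; apply: eq_bigr => i _; rewrite muln0 expr0 mul1r addn1.
rewrite (_ : take 1 (drop i s) = [:: s`_i]) ?one //.
by rewrite (drop_nth 0) ?sn //= take0.
Qed.
End Tuples.

(** * Cocycles are determined on paths *)

Section NormalForm.
Variables (k : fieldType) (Q : quiver).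
Hypothesis hQ : forall v : vtx Q, ~ oriented_cycle (component v).
Variable m : nat.
Local Notation A := (radsq0 k Q).
Local Notation vtxA e := (radsq0_vtx k e).
Local Notation coef := radsq0_coef.
Local Notation arrs s := (map (@radsq0_arr k Q) s).
Local Notation R := (regular_bimodule k Q).

Lemma normalized_par_seq n (v : kpar k Q n 1) : normalized n (par_seq v).
Proof.
move=> p e s pn; rewrite /par_seq big1 // => q _.
by rewrite normalized_path_cochain ?scaler0 // size_tuple.
Qed.

Definition basis_tgt (b : vtx Q + arr Q) : vtx Q :=
  match b with inl e => e | inr y => tgt y end.
Definition basis_src (b : vtx Q + arr Q) : vtx Q :=
  match b with inl e => e | inr y => src y end.

Lemma coef_vtx_mul e (x : A) b :
  coef (vtxA e * x) b = (e == basis_tgt b)%:R * coef x b.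
Proof.
rewrite radsq0_coef_mul; case: b => [f|y]; rewrite !radsq0_coef_vec eq_sym //.
by rewrite -[inr y == inl e]/false mul0r addr0.
Qed.

Lemma coef_mul_vtx e (x : A) b :
  coef (x * vtxA e) b = (e == basis_src b)%:R * coef x b.
Proof.
rewrite radsq0_coef_mul; case: b => [f|y];
  rewrite !radsq0_coef_vec mulrC [e == _]eq_sym //.
by rewrite -[inr y == inl e]/false mul0r add0r mulrC.
Qed.

(** The values of a normalized cocycle on paths are E-bilinear, so they only
    involve vertices and arrows parallel to the path. *)
Lemma normalized_coef_parallel (G : seq A -> R) a s b :
    mlin m.+1 G -> normalized m.+1 G -> is_cocycle m.+1 G -> size s = m ->
    coef (G (arrs (a :: s))) b <> 0 ->
  is_path (basis_tgt b) (a :: s) /\ last (basis_tgt b) (map (@src Q) (a :: s)) =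
    basis_src b.
Proof.
move=> mG nG cG sn g0; split.
  apply: contrapT => /negP/negPf np; apply: g0; rewrite -[LHS]mul1r.
  have := normalized_lact_vtx (basis_tgt b) (s := a :: s) mG nG cG
    (congr1 succn sn).
  rewrite np => /(congr1 (fun x => coef x b)).
  by rewrite -[lact _ _]/(vtxA _ * G _) coef_vtx_mul eqxx radsq0_coef0.
rewrite /= last_map; apply: contrapT => /eqP/negPf np; apply: g0.
have := normalized_ract_vtx a nG cG sn => /(congr1 (fun x => coef x b)) <-.
by rewrite -[ract _ _]/(G _ * vtxA _) coef_mul_vtx np mul0r.
Qed.

(** Vertices cannot occur in the values on paths, because res_vtx G is in the
    kernel of parD. *)
Lemma normalized_cocycleE (G : seq A -> R) s :
    mlin m.+1 G -> normalized m.+1 G -> is_cocycle m.+1 G -> size s = m.+1 ->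
  G s = par_seq (res_arr m.+1 G) s.
Proof.
move=> mG nG cG sn; apply/eqP; rewrite -subr_eq0; apply/eqP.
rewrite -[LHS]/((G - par_seq (res_arr m.+1 G)) s).
apply: (mlin_arr_eq0 _ _ _ sn) => [||{sn}s sn].
- exact: mlinB mG (mlin_par_seq _).
- move=> p e t pn; rewrite -[LHS]/(G _ - par_seq _ _).
  by rewrite nG // normalized_par_seq // subrr.
rewrite -[LHS]/(G (arrs s) - par_seq (res_arr m.+1 G) (arrs s)).
apply/eqP; rewrite subr_eq0; apply/eqP.
apply: radsq0P => b; apply: contrapT => ne.
case: s => [//|a s] in sn ne *; move: sn ne => [sn].
have sm : size (a :: s) == m.+1 by rewrite /= sn.
rewrite -[a :: s]/(tval (Tuple sm)) => ne.
have par_nz : coef (par_seq (res_arr m.+1 G) (arrs (Tuple sm))) b <> 0 ->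
    exists q : par Q m.+1 1, arrows (par1 q) = Tuple sm /\ b =
      inr (arrow_of (par2 q)).
  rewrite par_seq_arrs ?size_tuple // radsq0_coef_sum => nz; apply: contrapT => nq.
  apply: nz; rewrite big1 // => q /eqP qa; rewrite radsq0_coefZ radsq0_coef_vec.
  case: eqP => [bE|]; last by rewrite mulr0.
  by case: nq; exists q; split; [exact: val_inj|].
have [G0|/eqP Gnz] := eqVneq (coef (G (arrs (Tuple sm))) b) 0.
  have [P0|/eqP/par_nz[q [qa qb]]] :=
    eqVneq (coef (par_seq (res_arr m.+1 G) (arrs (Tuple sm))) b) 0.
    by apply: ne; rewrite G0 P0.
  by apply: ne; rewrite -qa qb coef_par_seq ffunE.
have [pb lb] := normalized_coef_parallel mG nG cG sn Gnz.
case: b => [e|y] in ne par_nz Gnz pb lb *; last first.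
  have [q [qa qy]] := @mk_par1 _ _ (Tuple sm) y pb lb.
  by apply: ne; rewrite -qa -qy coef_par_seq ffunE.
have [q [qa qe]] := @mk_par0 _ _ (Tuple sm) e pb lb.
have w0 : res_vtx m.+1 G = 0.
  apply: (parD_inj hQ); rewrite -res_arr_dif //.
  by apply/ffunP => q'; rewrite !ffunE cG ?radsq0_coef0 // size_map size_tuple.
by apply: Gnz; move/ffunP/(_ q): w0; rewrite !ffunE qa qe.
Qed.

(** Let G = F - dif H be normalized. Then res_arr F and res_arr G differ by
    parD (res_vtx H), whose cochain is the coboundary of closed_path_seq
    (res_vtx H). *)
Lemma cocycle_decomp (F : seq A -> R) : mlin m.+1 F -> is_cocycle m.+1 F ->
  exists2 H, mlin m H &
    forall s, size s = m.+1 -> F s - par_seq (res_arr m.+1 F) s = dif H s.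
Proof.
move=> mF cF.
have [B [H [mH _ BH]] nB] := normalize_cocycle (unital_regular k Q) (fun _ _ => I)
  mF cF.
pose G := F - dif H.
have FG s : size s = m.+1 -> (F - B) s = G s.
  by move=> sn; rewrite -[LHS]/(F s - B s) BH.
have mG : mlin m.+1 G.
  by apply: mlinB mF (mlin_dif (unital_regular k Q) (fun _ _ => I) mH).
have nG : normalized m.+1 G by move=> p e s pn; rewrite -FG ?nB // size_cat.
have cG : is_cocycle m.+1 G by move=> s sn; rewrite difB dif_dif cF // subr0.
pose w := res_vtx m H.
exists (H - closed_path_seq w); first exact: mlinB mH (mlin_closed_path_seq w).
move=> s sn; rewrite difB -par_seq_parD // -res_arr_dif //.
have E : par_seq (res_arr m.+1 G) s =
  par_seq (res_arr m.+1 F) s - par_seq (res_arr m.+1 (dif H)) s.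
  rewrite -scaleN1r -par_seqZ addrC -par_seqD -res_arr_linear.
  by congr (par_seq (res_arr _ _) _); rewrite /G scaleN1r addrC.
have {E} : F s - dif H s = par_seq (res_arr m.+1 F) s - par_seq
  (res_arr m.+1 (dif H)) s.
  by rewrite -E -normalized_cocycleE.
move=> E; rewrite -[F s](subrK (dif H s)) E.
by rewrite -[X in X - _]addrA addrAC subrr add0r addrC.
Qed.
End NormalForm.

(** * The isomorphism from parallel paths to cohomology *)

Section Iso.
Variables (k : fieldType) (Q : quiver).
Local Notation A := (radsq0 k Q).
Local Notation vtxA e := (radsq0_vtx k e).
Local Notation R := (regular_bimodule k Q).

Lemma res_arr_ext n (F G : seq A -> A) :
  (forall s, size s = n -> F s = G s) -> res_arr n F = res_arr n G.
Proof. by move=> FG; apply/ffunP => q;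
  rewrite !ffunE FG // size_map size_tuple. Qed.

Lemma seqfun_par_cochain n (v : kpar k Q n 1) s : size s = n ->
  seqfun (par_cochain v) s = par_seq v s.
Proof.
by move=> /eqP sn; rewrite -[s]/(tval (Tuple sn)) seqfunE par_cochainE.
Qed.

Lemma cocycle_ext n (F G : seq A -> R) :
  (forall s, size s = n -> F s = G s) -> is_cocycle n F -> is_cocycle n G.
Proof.
move=> FG cF s sn; rewrite -(cF s sn); apply: (@dif_ext k Q R) => r.
by rewrite sn => -[/FG ->].
Qed.

Lemma par_cochain_cocycle n (v : kpar k Q n 1) : par_cochain v \in @cocycle_pred k
  Q n.
Proof.
have E s : size s = n -> par_seq v s = seqfun (par_cochain v) s.
  by move=> /seqfun_par_cochain ->.
apply/cocycle_predE; split; first exact: mlin_ext E (mlin_par_seq v).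
exact: cocycle_ext E (dif_par_seq v).
Qed.

Definition par_cocycle n (v : kpar k Q n 1) : cocycle k Q n :=
  Cocycle (par_cochain_cocycle v).

Lemma par_cocycle_linear n : linear (@par_cocycle n).
Proof.
move=> c u v; apply: val_inj; apply: funext => t.
rewrite [RHS]/(c *: par_cochain u t + par_cochain v t) /= !par_cochainE.
exact: par_seq_linear.
Qed.
HB.instance Definition _ n := GRing.isLinear.Build k (kpar k Q n 1)
  (cocycle k Q n) *:%R
  (@par_cocycle n) (@par_cocycle_linear n).

Lemma mem_imDP n (v : kpar k Q n.+1 1) :
  reflect (exists w, v = parD w) (v \in imD k Q n.+1).
Proof.
apply: (iffP memv_imgP) => [[w _ ->]|[w ->]].
  by exists w; rewrite lfunE.
by exists w; rewrite ?memvf // lfunE.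
Qed.

Lemma kpar_class_eq n (u v : kpar k Q n 1) :
  kpar_class u = kpar_class v <-> u - v \in imD k Q n.
Proof. by split=> [/eqP|uv]; [|apply/eqP]; rewrite lclass_eqE. Qed.

(** The preimage w is obtained by restricting a bounding cochain to closed
    paths. *)
Lemma coboundary_par_cocycle n (v : kpar k Q n.+1 1) :
  (par_cocycle v \in @coboundary_pred k Q n.+1) = (v \in imD k Q n.+1).
Proof.
apply/asboolP/mem_imDP => [/coboundaryE[H mH vH]|[w ->]].
  exists (res_vtx n H); rewrite -res_arr_dif // -[LHS]res_arr_par_seq.
  by apply: res_arr_ext => s sn; rewrite -vH // seqfun_par_cochain.
apply/coboundaryE; exists (closed_path_seq w); first exact: mlin_closed_path_seq.
by move=> s sn; rewrite /= seqfun_par_cochain // par_seq_parD.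
Qed.

Section Phi.
Variable n : nat.

Definition par_to_HH (c : kpar_quot k Q n.+1) : HH k Q n.+1 :=
  lclass _ (par_cocycle (lrepr c)).

Lemma par_to_HHE v : par_to_HH (kpar_class v) = lclass _ (par_cocycle v).
Proof.
apply/eqP; rewrite lclass_eqE -linearB coboundary_par_cocycle.
by apply/kpar_class_eq; rewrite /kpar_class lreprK.
Qed.

Lemma par_to_HH_linear : linear par_to_HH.
Proof.
move=> c x y; rewrite -[x]lreprK -[y]lreprK -linearP -!/(kpar_class _) !par_to_HHE.
by rewrite !linearP.
Qed.
HB.instance Definition _ := GRing.isLinear.Build k (kpar_quot k Q n.+1)
  (HH k Q n.+1) *:%R
  par_to_HH par_to_HH_linear.

Lemma par_to_HH_represents v : represents (par_cochain v)
  (par_to_HH (kpar_class v)).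
Proof. by exists (par_cocycle v); rewrite ?par_to_HHE. Qed.

Hypothesis hQ : forall v : vtx Q, ~ oriented_cycle (component v).

Lemma par_to_HH_res_arr (z : cocycle k Q n.+1) :
  par_to_HH (kpar_class (res_arr n.+1 (seqfun z))) = lclass _ z.
Proof.
have /cocycle_predE[mz cz] := cocycleP z.
have [H mH zH] := cocycle_decomp hQ mz cz.
apply/esym/eqP; rewrite par_to_HHE lclass_eqE; apply/asboolP/coboundaryE;
  exists H => // s sn.
by rewrite -zH // -seqfun_par_cochain.
Qed.

Lemma par_to_HH_bij : bijective par_to_HH.
Proof.
exists (fun c : HH k Q n.+1 => kpar_class (res_arr n.+1 (seqfun (lrepr c)))) =>
  [x|c]; last first.
  by rewrite par_to_HH_res_arr lreprK.
rewrite -[x]lreprK -/(kpar_class _) par_to_HHE; set v := lrepr x.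
apply/kpar_class_eq; rewrite -coboundary_par_cocycle linearB /= -lclass_eqE.
by rewrite -par_to_HHE par_to_HH_res_arr lreprK.
Qed.
End Phi.
End Iso.

(** * The bracket on paths *)

Section Bracket.
Variables (k : fieldType) (Q : quiver).
Local Notation A := (radsq0 k Q).
Local Notation arrA a := (radsq0_arr k a).
Local Notation coef := radsq0_coef.
Local Notation arrs s := (map (@radsq0_arr k Q) s).
Local Notation R := (regular_bimodule k Q).

Lemma lie_diagonal (f : A -> A) (c : arr Q -> k) n (F : seq A -> R)
  (s : seq (arr Q)) :
    (forall a, f (arrA a) = c a *: arrA a) -> mlin n F -> size s = n ->
  lie f F (arrs s) = f (F (arrs s)) - (\sum_(a <- s) c a) *: F (arrs s).
Proof.
move=> fa; elim: n F s => [|n IH] F [|a s] //.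
  by move=> _ _; rewrite big_nil scale0r subr0.
move=> [linF mF] [sn]; rewrite /= (IH _ _ (mF _) sn) fa big_cons scalerDl.
have Z : F (c a *: arrA a :: arrs s) = c a *: F (arrA a :: arrs s).
  have lF := linF (arrs s); rewrite size_map in lF.
  by have := lF sn (c a) (arrA a) 0; rewrite (linear_fun0 (lF sn)) !addr0.
by rewrite Z opprD addrA addrAC.
Qed.

Lemma sum_path_telescope (h : vtx Q -> k) e (s : seq (arr Q)) : is_path e s ->
  \sum_(a <- s) (h (src a) - h (tgt a)) = h (last e (map (@src Q) s)) - h e.
Proof.
elim: s e => [|a s IH] e /=; first by rewrite big_nil subrr.
by move=> /andP[/eqP <- pa]; rewrite big_cons (IH _ pa) addrC addrA subrK.
Qed.

(** Commutators with x multiply an arrow a by the difference of the coordinates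
    of x at the source and at the end of a. Summed along a path, these
    differences telescope to the one of an arrow parallel to the path. *)
Lemma lie_inner n (v : kpar k Q n 1) (x : A) s : size s = n ->
  lie (fun y => y * x - x * y) (par_seq v) (arrs s) = 0.
Proof.
move=> sn; pose c (a : arr Q) := coef x (inl (src a)) - coef x (inl (tgt a)).
have adE a : arrA a * x - x * arrA a =
  c a *: arrA a by rewrite arr_mul mul_arr scalerBl.
rewrite (@lie_diagonal _ c n) //; last exact: mlin_par_seq.
rewrite par_seq_arrs // mulr_suml mulr_sumr scaler_sumr -!sumrB big1 // =>
  q /eqP qs.
have [pq lq] := par1P q; rewrite qs in pq lq.
rewrite (sum_path_telescope (fun e => coef x (inl e)) pq) lq -/(c _).
by rewrite -radsq0_scaleAl -radsq0_scaleAr -scalerBr adE !scalerA mulrC subrr.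
Qed.

Lemma path_coef_replace n (al : n.-tuple (arr Q)) (i : 'I_n) (t : n.-tuple A) z :
  path_coef al (take i t ++ z :: drop i.+1 t) =
  coef z (inr (tnth al i)) * \prod_(j < n | j != i) coef (tnth t j)
    (inr (tnth al j)).
Proof.
rewrite -replace_tupleE -path_coef_tuple (bigD1 i) //= tnth_mktuple eqxx;
  congr (_ * _).
by apply: eq_bigr => j ji; rewrite tnth_mktuple (negPf ji).
Qed.

Lemma coef_par_seq1 (u : kpar k Q 1 1) (x : A) b :
  coef (par_seq u [:: x]) (inr b) =
  \sum_p (u : {ffun _ -> _}) p *
    (coef x (inr (arrow_of (par1 p))) * (b == arrow_of (par2 p))%:R).
Proof.
rewrite radsq0_coef_sum; apply: eq_bigr => p _;
  rewrite radsq0_coefZ /path_cochain radsq0_coefZ.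
rewrite radsq0_coef_vec; congr (_ * (_ * _)); rewrite /arrow_of.
by case/tupleP: (arrows (par1 p)) => a t; rewrite [t]tuple0 theadE /= mulr1.
Qed.

Lemma par_seq1_linear (u : kpar k Q 1 1) : linear
  (fun x : A => par_seq u [:: x] : A).
Proof. by have [lu _] := mlin_par_seq u; exact: lu. Qed.

(** For basis vectors (a, x) and (al, y), the bracket has two kinds of terms on
    a path be. Applying (a, x) to the value of (al, y) gives x when y = a and
    be = al. Applying (a, x) to the i-th argument turns an arrow a of be into
    x, and the result is al when be is al with its i-th arrow x replaced by a.
    Both the coordinate of the modified arguments on al and the test that be is
    the modified path split off the i-th factor and share the product of the
    others. *)
Lemma res_arr_lie_par_seq n (u : kpar k Q 1 1) (v : kpar k Q n 1) :
  res_arr n (lie (fun x => par_seq u [:: x]) (par_seq v)) = par_act u v.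
Proof.
apply/ffunP => q; rewrite ffunE lieE radsq0_coefD -scaleN1r radsq0_coefZ mulN1r.
rewrite size_map size_tuple.
set be := arrows (par1 q); set z := arrow_of (par2 q).
rewrite coef_par_seq1 radsq0_coef_sum sum_ffunE.
under [RHS]eq_bigr => p _ do rewrite sum_ffunE.
(* T1 and T2 are the contributions of the basis vectors p of u and r of v. *)
pose T1 (p : par Q 1 1) (r : par Q n 1) : k := (u : {ffun _ -> _}) p *
  (v : {ffun _ -> _}) r *
  ((arrow_of (par2 r) == arrow_of (par1 p))%:R *
   ((be == arrows (par1 r)) && (z == arrow_of (par2 p)))%:R).
pose T2 (p : par Q 1 1) (r : par Q n 1) (i : 'I_n) : k := (u : {ffun _ -> _}) p *
  (v : {ffun _ -> _}) r *
  ((arrow_of (par2 p) == tnth (arrows (par1 r)) i)%:R *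
   ((be == replace_arrow (arrows (par1 r)) i (arrow_of (par1 p))) &&
     (z == arrow_of (par2 r)))%:R).
transitivity (\sum_p \sum_r (T1 p r - \sum_i T2 p r i)); last first.
  apply: eq_bigr => p _; apply: eq_bigr => r _.
  rewrite !ffunE sum_ffunE -[RHS]/(_ * _) mulrBr; congr (_ - _).
  by rewrite mulr_sumr; apply: eq_bigr => i _; rewrite !ffunE.
have -> : \sum_p \sum_r (T1 p r - \sum_i T2 p r i) =
    \sum_p \sum_r T1 p r - \sum_i \sum_r \sum_p T2 p r i.
  rewrite [X in _ - X]exchange_big
    [X in _ - X](eq_bigr (fun r => \sum_p \sum_i T2 p r i)); last first.
    by move=> r _; rewrite exchange_big.
  by rewrite [X in _ - X]exchange_big -sumrB; apply: eq_bigr => p _; rewrite -sumrB.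
congr (_ - _).
  apply: eq_bigr => p _; rewrite -[be]/(arrows _) par_seq_arrs ?size_tuple //.
  rewrite radsq0_coef_sum mulr_suml mulr_sumr big_mkcond; apply: eq_bigr => r _.
  rewrite /T1 -val_eqE eq_sym; case: eqP => [_|_]; last by rewrite !mulr0.
  rewrite radsq0_coefZ radsq0_coef_vec /=
    -[inr _ == inr _]/(arrow_of (par1 p) == arrow_of (par2 r)).
  by rewrite [_ == arrow_of (par2 r)]eq_sym; ring.
apply: eq_bigr => i _; rewrite radsq0_coef_sum; apply: eq_bigr => r _.
rewrite radsq0_coefZ /path_cochain radsq0_coefZ radsq0_coef_vec.
pose bt : n.-tuple A := [tuple of arrs be].
have bE : (arrs be)`_i = arrA (tnth be i).
  by rewrite (nth_map (tnth be i)) ?size_tuple // -tnth_nth.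
rewrite bE -[arrs be]/(tval bt) path_coef_replace coef_par_seq1 mulr_suml
  mulr_suml mulr_sumr.
apply: eq_bigr => p _; rewrite /T2.
set K := \prod_(j < n | _) _.
have -> : ((be == replace_arrow (arrows (par1 r)) i (arrow_of (par1 p))) &&
  (z == arrow_of (par2 r)))%:R =
   (tnth be i == arrow_of (par1 p))%:R * K * (z == arrow_of (par2 r))%:R :> k.
  rewrite -mulnb natrM; congr (_ * _).
  rewrite -val_eqE eq_sym -path_coef_arrs ?size_tuple // -[map _ _]/(tval bt)
    -path_coef_tuple.
  rewrite (bigD1 i) //= !tnth_mktuple eqxx tnth_map radsq0_coef_vec eq_sym;
    congr (_ * _).
  by apply: eq_bigr => j ji; rewrite tnth_mktuple (negPf ji).
rewrite radsq0_coef_vec -[inr _ == inr _]/(arrow_of (par1 p) == tnth be i)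
  [tnth be i == _]eq_sym.
rewrite -[inr z == inr _]/(z == arrow_of (par2 r)) [arrow_of (par2 p) == _]eq_sym.
by ring.
Qed.

(** The inner part y x - x y of f contributes nothing, and dif H only an
    element of the image of parD since the Lie derivative commutes with dif. *)
Lemma res_arr_bracket n (u : kpar k Q 1 1) (v : kpar k Q n.+1 1) (x : A)
    (f : A -> A) (G H : seq A -> R) :
    (forall y, f y = par_seq u [:: y] + (y * x - x * y)) ->
    (forall y z, f (y * z) = f y * z + y * f z) -> mlin n H ->
    (forall s, size s = n.+1 -> G s = par_seq v s + dif H s) ->
  res_arr n.+1 (lie f G) - par_act u v = parD (res_vtx n (lie f H)).
Proof.
move=> fE df mH GE.
have lf : linear f.
  move=> c y z; rewrite !fE par_seq1_linear mulrDl mulrDr -radsq0_scaleAl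
    -radsq0_scaleAr.
  by rewrite scalerDr scalerBr opprD [X in _ + X = _]addrACA [LHS]addrACA.
rewrite -(res_arr_dif (mlin_lie lf mH)) -res_arr_lie_par_seq.
apply/ffunP => q; rewrite !ffunE; set s := arrs _.
have sn : size s = n.+1 by rewrite size_map size_tuple.
have -> : lie f G s = lie f (par_seq v) s + lie f (dif H) s.
  rewrite -[lie f (par_seq v) s]scale1r -lieP //; apply: lie_ext => r rs.
  by rewrite GE ?rs // scale1r.
have -> : lie f (par_seq v) s = lie (fun y => par_seq u [:: y]) (par_seq v) s.
  rewrite (_ : f = fun y => par_seq u [:: y] + (y * x - x * y)); last exact: funext.
  by rewrite (lie_addf _ _ (mlin_par_seq v) sn) lie_inner ?size_tuple // addr0.
by rewrite (dif_lie lf df mH sn) radsq0_coefD addrAC subrr add0r.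
Qed.
End Bracket.

(** * The bracket in cohomology *)

Section Main.
Variables (k : fieldType) (Q : quiver).
Local Notation A := (radsq0 k Q).
Local Notation R := (regular_bimodule k Q).

Lemma seqfun1 (f : 1.-tuple A -> A) x : seqfun f [:: x] = f [tuple x].
Proof. exact: (seqfunE f [tuple x]). Qed.

Lemma derivation_of_cocycle (f : 1.-tuple A -> A) : f \in @cocycle_pred k Q 1 ->
  forall x y, f [tuple x * y] = f [tuple x] * y + x * f [tuple y].
Proof.
move=> /cocycle_predE[_ cf] x y; have := cf [:: x; y] erefl.
rewrite -[dif _ _]/(x * seqfun f [:: y] +
  (- seqfun f [:: x * y] - - (seqfun f [:: x] * y))).
rewrite !seqfun1 opprK addrA addrAC => /eqP; rewrite subr_eq0 => /eqP <-.
exact: addrC.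
Qed.

Lemma linear_of_cocycle (f : 1.-tuple A -> A) : f \in @cocycle_pred k Q 1 ->
  linear (fun x => f [tuple x]).
Proof.
move=> /cocycle_predE[[lf _] _] c x y; rewrite -!seqfun1; exact: lf.
Qed.

Lemma bracket_cocycle n (f : 1.-tuple A -> A) (g : n.-tuple A -> A) :
    f \in @cocycle_pred k Q 1 -> g \in @cocycle_pred k Q n ->
  gbracket f g \in @cocycle_pred k Q n.
Proof.
move=> cf /cocycle_predE[mg cg].
have lf := linear_of_cocycle cf; have df := derivation_of_cocycle cf.
have E s : size s = n -> lie (fun x => f [tuple x]) (seqfun g) s =
  seqfun (gbracket f g : n.-tuple A -> A) s.
  by move=> sn; rewrite -gbracketE.
apply/cocycle_predE; split; first exact: mlin_ext E (mlin_lie lf mg).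
apply: cocycle_ext E _ => s sn; rewrite (dif_lie lf df mg sn).
have -> : lie (fun x => f [tuple x]) (dif (seqfun g)) s =
  lie (fun x => f [tuple x]) 0 s.
  by apply: lie_ext => r rs; rewrite cg // rs.
have := lieP (-1) 0 0 s lf; rewrite scaler0 addr0 scaleN1r addNr; exact.
Qed.

Lemma represents_par_to_HH n (f : n.+1.-tuple A -> A) (v : kpar k Q n.+1 1) :
    represents f (par_to_HH (kpar_class v)) ->
  f \in @cocycle_pred k Q n.+1 /\
  exists2 H : seq A -> R, mlin n H &
    forall s, size s = n.+1 -> seqfun f s = par_seq v s + dif H s.
Proof.
move=> [z <-]; rewrite par_to_HHE => /eqP; rewrite lclass_eqE =>
  /asboolP/coboundaryE[H mH zH].
split; first exact: cocycleP.
exists H => // s sn; rewrite -zH // -(seqfun_par_cochain v sn).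
by rewrite /seqfun /= addrC subrK.
Qed.

End Main.

Theorem theorem4p3 (k : fieldType) (Q : quiver) (n : nat)
  (hQ : forall v : vtx Q, ~ oriented_cycle (component v))
  (hn : (1 <= n)%N) :
  exists (phi1 : {linear kpar_quot k Q 1 -> HH k Q 1})
         (phin : {linear kpar_quot k Q n -> HH k Q n}),
  [/\ bijective phi1 /\
        (forall u : kpar k Q 1 1, represents (par_cochain u) (phi1 (kpar_class u))),
      bijective phin /\
        (forall v : kpar k Q n 1, represents (par_cochain v) (phin (kpar_class v)))
    & forall (u : kpar k Q 1 1) (v : kpar k Q n 1)
             (f : 1.-tuple (radsq0 k Q) -> radsq0 k Q)
             (g : n.-tuple (radsq0 k Q) -> radsq0 k Q),
        represents f (phi1 (kpar_class u)) ->
        represents g (phin (kpar_class v)) ->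
        represents (gbracket f g) (phin (kpar_class (par_act u v)))].
Proof.
case: n hn => // n _; exists (@par_to_HH k Q 0), (@par_to_HH k Q n); split.
- by split; [exact: par_to_HH_bij | exact: par_to_HH_represents].
- by split; [exact: par_to_HH_bij | exact: par_to_HH_represents].
move=> u v f g /represents_par_to_HH[cf [X _ fX]]
  /represents_par_to_HH[cg [H mH gH]].
(* X [::] is the element of A whose commutator is the coboundary in f. *)
pose z := Cocycle (bracket_cocycle cf cg).
exists z => //; rewrite -(par_to_HH_res_arr hQ z); congr par_to_HH.
apply/kpar_class_eq/mem_imDP; exists (res_vtx n (lie (fun x => f [tuple x]) H)).
rewrite -(@res_arr_bracket _ _ _ u v (X [::]) _ (seqfun g)) //.
- congr (_ - _); apply: res_arr_ext => s sn; exact: gbracketE.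
- by move=> y; rewrite -seqfun1 fX.
- exact: derivation_of_cocycle.
Qed.
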